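(* Let $\mathbf{k}$ be a unitary commutative ring, $\lambda\in\mathbf{k}$, and $X$ a set. Let $H=\mathbf{k}\mathfrak{X}_\infty$ be the free Rota-Baxter algebra of weight $\lambda$ on $X$ realized on Rota-Baxter bracketed words, with product $\diamond$, and let $\Delta:H\to H\otimes H$ and $\varepsilon:H\to\mathbf{k}$ be the linear maps defined in the context. Let $u:\mathbf{k}\to H$ be the linear map with $1_{\mathbf{k}}\mapsto1$. Then the quintuple $(H,\diamond,u,\Delta,\varepsilon)$ is a $\mathbf{k}$-bialgebra.
   Context: All algebras are unitary over a unitary commutative ring $\mathbf{k}$. For a set $Y$, $M(Y)$ is the free monoid on $Y$ and $S(Y)=M(Y)\setminus\{1\}$ is the free semigroup; $\lfloor Y\rfloor=\{\lfloor y\rfloor\mid y\in Y\}$ is a set of symbols indexed by $Y$ and disjoint from $Y$. Bracketed words: put $\mathfrak{M}_0=M(X)$ and $\mathfrak{M}_{n+1}=M(X\cup\lfloor\mathfrak{M}_n\rfloor)$ for $n\ge0$. The natural inclusions $\mathfrak{M}_n\hookrightarrow\mathfrak{M}_{n+1}$ make these a direct system; its union is the monoid $\mathfrak{M}(X)=\varinjlim\mathfrak{M}_n$ (product: concatenation, identity $1$), which carries the map $w\mapsto\lfloor w\rfloor$. Rota-Baxter bracketed words (RBWs): for subsets $Y,Z$ of $\mathfrak{M}(X)$ let $$\Lambda(Y,Z)=\bigcup_{r\ge1}(Y\lfloor Z\rfloor)^r\cup\bigcup_{r\ge0}(Y\lfloor Z\rfloor)^rY\cup\bigcup_{r\ge1}(\lfloor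 Z\rfloor Y)^r\cup\bigcup_{r\ge0}(\lfloor Z\rfloor Y)^r\lfloor Z\rfloor\cup\{1\}.$$ Put $\mathfrak{X}_0=M(X)$, $\mathfrak{X}_n=\Lambda(S(X),\mathfrak{X}_{n-1})$ for $n\ge1$, and $\mathfrak{X}_\infty=\bigcup_{n\ge0}\mathfrak{X}_n$. The depth of $w\in\mathfrak{X}_\infty$ is $\mathrm{dep}(w)=\min\{n\mid w\in\mathfrak{X}_n\}$. Every RBW $w\ne1$ has a unique standard decomposition $w=w_1\cdots w_b$ (concatenation) with the $w_i$ alternately in $S(X)$ and in $\lfloor\mathfrak{X}_\infty\rfloor$; $b$ is the breadth of $w$. Product $\diamond$: it is the $\mathbf{k}$-bilinear product on $\mathbf{k}\mathfrak{X}_\infty$ (the free $\mathbf{k}$-module on $\mathfrak{X}_\infty$) with unit $1$ defined on basis elements by induction on $\mathrm{dep}(w)+\mathrm{dep}(w')$. If $w,w'$ both have breadth $1$, then $w\diamond w'=ww'$ (concatenation) if $w\in S(X)$ or $w'\in S(X)$, and $$\lfloor\bar w\rfloor\diamond\lfloor\bar w'\rfloor=\lfloor\lfloor\bar w\rfloor\diamond\bar w'\rfloor+\lfloor\bar w\diamond\lfloor\bar w'\rfloor\rfloor+\lambda\lfloor\bar w\diamond\bar w'\rfloor,$$ with $\lfloor\cdot\rfloor$ extended linearly. For $w,w'\neq1$ with standard decompositions $w=w_1\cdots w_m$ and $w'=w'_1\cdots w'_{m'}$, $w\diamond w'=w_1\cdots w_{m-1}(w_m\diamond w'_1)w'_2\cdots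 w'_{m'}$, with the other products being concatenation, extended linearly. Let $P:\mathbf{k}\mathfrak{X}_\infty\to\mathbf{k}\mathfrak{X}_\infty$ be the linear map with $P(w)=\lfloor w\rfloor$. It is known that $(\mathbf{k}\mathfrak{X}_\infty,\diamond,P)$ is the free (noncommutative, unital associative) Rota-Baxter algebra of weight $\lambda$ on $X$, where a Rota-Baxter operator of weight $\lambda$ satisfies $P(u)P(v)=P(uP(v))+P(P(u)v)+\lambda P(uv)$. Alternating factorization: a sequence in $X\cup\lfloor\mathfrak{X}_\infty\rfloor$ is alternating if no two consecutive elements are both in $\lfloor\mathfrak{X}_\infty\rfloor$. Every $w\in\mathfrak{X}_\infty$ is uniquely $w=w_1\cdots w_m=w_1\diamond\cdots\diamond w_m$ with $w_1,\dots,w_m$ alternating ($m=0$ for $w=1$). Coproduct: with $H=\mathbf{k}\mathfrak{X}_\infty$ and $H\otimes H$ having the componentwise product, also denoted $\diamond$, the linear map $\Delta:H\to H\otimes H$ is defined on $\mathfrak{X}_\infty$ recursively by $\Delta(1)=1\otimes1$; $\Delta(x)=x\otimes1+1\otimes x$ for $x\in X$; $\Delta(\lfloor\bar w\rfloor)=\lfloor\bar w\rfloor\otimes1+(\mathrm{id}\otimes P)\Delta(\bar w)$ for $\bar w\in\mathfrak{X}_\infty$; and $\Delta(w)=\Delta(w_1)\diamond\cdots\diamond\Delta(w_m)$ if $w$ has alternating factorization $w_1\diamond\cdots\diamond w_m$. Counit: $\varepsilon:H\to\mathbf{k}$ is the linear map with $\varepsilon(1)=1_{\mathbf{k}}$ and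 $\varepsilon(w)=0$ for $w\in\mathfrak{X}_\infty\setminus\{1\}$. A $\mathbf{k}$-bialgebra is a quintuple $(H,\mu,u,\Delta,\varepsilon)$ where $(H,\mu,u)$ is a $\mathbf{k}$-algebra, $(H,\Delta,\varepsilon)$ is a (coassociative, counital) $\mathbf{k}$-coalgebra, and $\Delta,\varepsilon$ are algebra homomorphisms. *)

(* Defs.v *)
From HB Require Import structures.
From mathcomp Require Import all_boot all_algebra finmap generic_quotient.
From mathcomp.classical Require Import boolp classical_sets.
From mathcomp.multinomials Require Import monalg.

Set Implicit Arguments.
Unset Strict Implicit.
Unset Printing Implicit Defensive.

Import GRing.Theory.

Local Open Scope ring_scope.
Local Open Scope quotient_scope.

(* [{malg k[K]}] is a [k]-module in the library only for nontrivial [k]; the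
   alias below carries the module structure over any commutative ring. *)
Definition freemod (k : comPzRingType) (K : choiceType) : Type := {malg k[K]}.

HB.instance Definition _ k K := GRing.Zmodule.on (freemod k K).

Section FreeModule.
Variables (k : comPzRingType) (K : choiceType).
Implicit Types (f g : freemod k K) (w : K).

Definition freemod_scale (c : k) f : freemod k K :=
  [malg w in msupp f => c * f@_w].

Lemma freemod_scaleE c f w : (freemod_scale c f)@_w = c * f@_w.
Proof. by rewrite mcoeffE; case: msuppP; rewrite ?mulr0. Qed.

Fact freemod_scaleA a b f :
  freemod_scale a (freemod_scale b f) = freemod_scale (a * b) f.
Proof. by apply/malgP => w; rewrite !freemod_scaleE mulrA. Qed.

Fact freemod_scale1 : left_id 1 freemod_scale.
Proof. by move=> f; apply/malgP => w; rewrite freemod_scaleE mul1r. Qed.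

Fact freemod_scaleDr : right_distributive freemod_scale +%R.
Proof.
by move=> a f g; apply/malgP => w; rewrite !(freemod_scaleE, mcoeffD) mulrDr.
Qed.

Fact freemod_scaleDl f : {morph freemod_scale^~ f : a b / a + b}.
Proof.
by move=> a b; apply/malgP => w; rewrite mcoeffD !freemod_scaleE mulrDl.
Qed.

HB.instance Definition _ := GRing.Zmodule_isLmodule.Build k (freemod k K)
  freemod_scaleA freemod_scale1 freemod_scaleDr freemod_scaleDl.

Definition fbasis w : freemod k K := << w >>.

Definition linext (M : lmodType k) (phi : K -> M) f : M :=
  \sum_(w <- msupp f) f@_w *: phi w.

End FreeModule.

Arguments fbasis {k K} w.

Lemma freemod_coefZ (k : comPzRingType) (K : choiceType) c (f : freemod k K) w :
  (c *: f : freemod k K)@_w = c * f@_w.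
Proof. exact: freemod_scaleE. Qed.

Lemma freemodE (k : comPzRingType) (K : choiceType) (f : freemod k K) :
  f = \sum_(w <- msupp f) f@_w *: fbasis w.
Proof.
rewrite {1}[f]monalgE; apply: eq_bigr => w _; apply/malgP => v.
by rewrite freemod_coefZ !mcoeffU mulrnAr mulr1.
Qed.

Section LinearExtension.
Variables (k : comPzRingType) (K : choiceType) (M : lmodType k).
Implicit Types (f g : freemod k K) (phi : K -> M).

Lemma linextEw phi f (D : {fset K}) : (msupp f `<=` D)%fset ->
  linext phi f = \sum_(w <- D) f@_w *: phi w.
Proof.
move=> sfD; rewrite /linext; apply: big_fset_incl => // w _.
by move/mcoeff_outdom ->; rewrite scale0r.
Qed.

Lemma linext_linear phi : linear (linext phi).
Proof.
move=> c f g; set D := (msupp (c *: f + g) `|` msupp f `|` msupp g)%fset.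
rewrite !(@linextEw _ _ D) ?fsubsetUr //; last first.
- exact: fsubset_trans (fsubsetUl _ _) (fsubsetUl _ _).
- exact: fsubset_trans (fsubsetUr _ _) (fsubsetUl _ _).
rewrite scaler_sumr -big_split /=; apply: eq_bigr => w _.
by rewrite mcoeffD freemod_coefZ scalerDl scalerA.
Qed.

Lemma linext_basis phi w : linext phi (fbasis w) = phi w.
Proof.
rewrite (@linextEw _ _ [fset w]%fset) ?msuppU_le //.
by rewrite big_seq_fset1 mcoeffUU scale1r.
Qed.

Lemma linext_unique (F : freemod k K -> M) : linear F ->
  F =1 linext (fun w => F (fbasis w)).
Proof.
move=> linF f; pose FL : {linear freemod k K -> M} :=
  HB.pack F (GRing.isLinear.Build k (freemod k K) M *:%R F linF).
rewrite {1}[f]freemodE -[F]/(FL : _ -> _) linear_sum.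
by apply: eq_bigr => w _; rewrite linearZ.
Qed.

Lemma freemod_linear_ext (F G : freemod k K -> M) : linear F -> linear G ->
  (forall w, F (fbasis w) = G (fbasis w)) -> F =1 G.
Proof.
move=> linF linG FG f; rewrite (linext_unique linF) (linext_unique linG).
by apply: eq_bigr => w _; rewrite FG.
Qed.

End LinearExtension.

Section TensorCongruence.
Variables (k : comPzRingType) (M N : lmodType k).

(* The sequence [:: (m1, n1); ...; (mr, nr)] stands for the formal sum of the
   symbols [mi (x) ni]. *)
Inductive tensor_eq : seq (M * N) -> seq (M * N) -> Prop :=
| TensorRefl s : tensor_eq s s
| TensorSym s t : tensor_eq s t -> tensor_eq t s
| TensorTrans s t r : tensor_eq s t -> tensor_eq t r -> tensor_eq s r
| TensorCat s s' t t' :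
    tensor_eq s s' -> tensor_eq t t' -> tensor_eq (s ++ t) (s' ++ t')
| TensorCatC s t : tensor_eq (s ++ t) (t ++ s)
| TensorAddl m m' n : tensor_eq [:: (m + m', n)] [:: (m, n); (m', n)]
| TensorAddr m n n' : tensor_eq [:: (m, n + n')] [:: (m, n); (m, n')]
| TensorScale (c : k) m n : tensor_eq [:: (c *: m, n)] [:: (m, c *: n)]
| TensorZero n : tensor_eq [:: (0, n)] [::].

Definition tensor_eqb : rel (seq (M * N)) := fun s t => `[< tensor_eq s t >].

Lemma tensor_eqP s t : reflect (tensor_eq s t) (tensor_eqb s t).
Proof. exact: asboolP. Qed.

Fact tensor_eqb_refl : reflexive tensor_eqb.
Proof. by move=> s; apply/tensor_eqP; apply: TensorRefl. Qed.

Fact tensor_eqb_sym : symmetric tensor_eqb.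
Proof. by move=> s t; apply/tensor_eqP/tensor_eqP; apply: TensorSym. Qed.

Fact tensor_eqb_trans : transitive tensor_eqb.
Proof.
by move=> t s r /tensor_eqP st /tensor_eqP tr; apply/tensor_eqP;
   apply: TensorTrans st tr.
Qed.

Canonical tensor_equiv :=
  EquivRel tensor_eqb tensor_eqb_refl tensor_eqb_sym tensor_eqb_trans.

Definition tensor : Type := {eq_quot tensor_equiv}.

HB.instance Definition _ := Choice.on tensor.
HB.instance Definition _ : EqQuotient _ tensor_equiv tensor :=
  EqQuotient.on tensor.

Lemma tensorW (P : tensor -> Prop) :
  (forall s, P (\pi_tensor s)) -> forall x, P x.
Proof. by move=> Ppi x; rewrite -[x]reprK. Qed.

Lemma tensor_piP s t : tensor_eq s t <-> \pi_tensor s = \pi_tensor t.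
Proof. by split=> [/tensor_eqP/eqmodP|/eqmodP/tensor_eqP]. Qed.

Definition pure (m : M) (n : N) : tensor := \pi_tensor [:: (m, n)].

Definition scale_seq (c : k) (s : seq (M * N)) : seq (M * N) :=
  [seq (c *: p.1, p.2) | p <- s].

Lemma tensor_eq_map (h : M -> M) (s t : seq (M * N)) :
    {morph h : x y / x + y} -> (forall c, {morph h : x / c *: x}) ->
  tensor_eq s t ->
  tensor_eq [seq (h p.1, p.2) | p <- s] [seq (h p.1, p.2) | p <- t].
Proof.
move=> hD hZ; have h0: h 0 = 0 by rewrite -[X in h X](scale0r 0) hZ scale0r.
elim=> {s t} /=.
- by move=> s; apply: TensorRefl.
- by move=> s t _; apply: TensorSym.
- by move=> s t r _ st _; apply: TensorTrans st.
- by move=> s s' t t' _ ? _ ?; rewrite !map_cat; apply: TensorCat.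
- by move=> s t; rewrite !map_cat; apply: TensorCatC.
- by move=> m m' n; rewrite hD; apply: TensorAddl.
- by move=> m n n'; apply: TensorAddr.
- by move=> c m n; rewrite hZ; apply: TensorScale.
- by move=> n; rewrite h0; apply: TensorZero.
Qed.

Definition tensor_add (x y : tensor) : tensor := \pi_tensor (repr x ++ repr y).
Definition tensor_scale (c : k) (x : tensor) : tensor :=
  \pi_tensor (scale_seq c (repr x)).
Definition tensor_opp (x : tensor) : tensor := tensor_scale (- 1) x.
Definition tensor_zero : tensor := \pi_tensor [::].

Lemma tensor_eq_repr s : tensor_eq (repr (\pi_tensor s)) s.
Proof. by apply/tensor_piP; rewrite reprK. Qed.

Lemma tensor_add_pi s t :
  tensor_add (\pi_tensor s) (\pi_tensor t) = \pi_tensor (s ++ t).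
Proof. by apply/tensor_piP; apply: TensorCat; apply: tensor_eq_repr. Qed.

Lemma tensor_scale_pi c s :
  tensor_scale c (\pi_tensor s) = \pi_tensor (scale_seq c s).
Proof.
apply/tensor_piP; apply: tensor_eq_map (tensor_eq_repr s) => [x y|d x].
  exact: scalerDr.
by rewrite !scalerA mulrC.
Qed.

Fact tensor_addA : associative tensor_add.
Proof.
move=> x y z; elim/tensorW: x => s; elim/tensorW: y => t; elim/tensorW: z => r.
by rewrite !tensor_add_pi catA.
Qed.

Fact tensor_addC : commutative tensor_add.
Proof.
move=> x y; elim/tensorW: x => s; elim/tensorW: y => t; rewrite !tensor_add_pi.
by apply/tensor_piP; apply: TensorCatC.
Qed.

Fact tensor_add0 : left_id tensor_zero tensor_add.
Proof. by move=> x; elim/tensorW: x => s; rewrite tensor_add_pi. Qed.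

Lemma tensor_eq_scaleD a b s :
  tensor_eq (scale_seq (a + b) s) (scale_seq a s ++ scale_seq b s).
Proof.
elim: s => [|[m n] s IHs] /=; first exact: TensorRefl.
rewrite scalerDl -/([:: (a *: m, n)] ++ _) -/([:: (b *: m, n)] ++ _).
apply: TensorTrans (TensorCat (TensorAddl _ _ _) IHs) _.
rewrite -[X in tensor_eq X _]/([:: (a *: m, n)] ++ [:: (b *: m, n)] ++ _).
rewrite -/([:: _] ++ (_ ++ _)); apply: TensorCat; first exact: TensorRefl.
rewrite !catA; apply: TensorCat; last exact: TensorRefl.
exact: TensorCatC.
Qed.

Lemma tensor_eq_scale0 s : tensor_eq (scale_seq 0 s) [::].
Proof.
elim: s => [|[m n] s IHs] /=; first exact: TensorRefl.
by rewrite scale0r -[X in tensor_eq _ X]cat0s; apply: (TensorCat (TensorZero n)).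
Qed.

Fact tensor_addN : left_inverse tensor_zero tensor_opp tensor_add.
Proof.
move=> x; elim/tensorW: x => s; rewrite /tensor_opp tensor_scale_pi tensor_add_pi.
apply/tensor_piP; apply: TensorTrans (tensor_eq_scale0 s).
rewrite -(addNr 1); apply: TensorTrans (TensorSym (tensor_eq_scaleD _ _ _)).
apply: TensorCat; first exact: TensorRefl.
suff ->: scale_seq 1 s = s by apply: TensorRefl.
by rewrite /scale_seq -[RHS]map_id; apply: eq_map => -[m n] /=; rewrite scale1r.
Qed.

HB.instance Definition _ := GRing.isZmodule.Build tensor
  tensor_addA tensor_addC tensor_add0 tensor_addN.

Lemma tensor_piD s t :
  \pi_tensor (s ++ t) = \pi_tensor s + \pi_tensor t :> tensor.
Proof. by rewrite -tensor_add_pi. Qed.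

Fact tensor_scaleA a b x :
  tensor_scale a (tensor_scale b x) = tensor_scale (a * b) x.
Proof.
elim/tensorW: x => s; rewrite !tensor_scale_pi /scale_seq -map_comp.
by congr (\pi_tensor _); apply: eq_map => -[m n] /=; rewrite scalerA.
Qed.

Fact tensor_scale1 : left_id 1 tensor_scale.
Proof.
move=> x; elim/tensorW: x => s; rewrite tensor_scale_pi /scale_seq.
by congr (\pi_tensor _); rewrite -[RHS]map_id; apply: eq_map => -[m n] /=;
   rewrite scale1r.
Qed.

Fact tensor_scaleDr : right_distributive tensor_scale +%R.
Proof.
move=> a x y; elim/tensorW: x => s; elim/tensorW: y => t.
by rewrite -tensor_piD !tensor_scale_pi -tensor_piD /scale_seq map_cat.
Qed.

Fact tensor_scaleDl x : {morph tensor_scale^~ x : a b / a + b}.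
Proof.
elim/tensorW: x => s a b; rewrite !tensor_scale_pi -tensor_piD.
by apply/tensor_piP; apply: tensor_eq_scaleD.
Qed.

HB.instance Definition _ := GRing.Zmodule_isLmodule.Build k tensor
  tensor_scaleA tensor_scale1 tensor_scaleDr tensor_scaleDl.

End TensorCongruence.

Arguments pure {k M N} m n.
Notation "m *t n" := (pure m n) (at level 40, left associativity).

Definition bilin (k : comPzRingType) (M N L : lmodType k) (f : M -> N -> L) :=
  (forall m, linear (f m)) /\ (forall n, linear (f^~ n)).

(* The value does not depend on the chosen representative only when [f] is
   bilinear: see [tlift_pure]. *)
Definition tlift (k : comPzRingType) (M N L : lmodType k) (f : M -> N -> L)
    (x : tensor M N) : L :=
  \sum_(p <- repr x) f p.1 p.2.

Definition tmap (k : comPzRingType) (M M' N N' : lmodType k)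
    (f : M -> M') (g : N -> N') : tensor M N -> tensor M' N' :=
  tlift (fun m n => f m *t g n).

Definition tassoc (k : comPzRingType) (M N L : lmodType k) :
    tensor (tensor M N) L -> tensor M (tensor N L) :=
  tlift (fun x l => tlift (fun m n => m *t (n *t l)) x).

Section TensorTheory.
Variables (k : comPzRingType) (M N L : lmodType k).
Implicit Types (m : M) (n : N) (x y : tensor M N) (f : M -> N -> L).

Lemma pure_bilin : bilin (@pure k M N).
Proof.
have pureDl m m' n : (m + m') *t n = m *t n + m' *t n :> tensor M N.
  by rewrite -tensor_piD; apply/tensor_piP; apply: TensorAddl.
have pureDr m n n' : m *t (n + n') = m *t n + m *t n' :> tensor M N.
  by rewrite -tensor_piD; apply/tensor_piP; apply: TensorAddr.
have pureZl c m n : (c *: m) *t n = c *: (m *t n) :> tensor M N.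
  exact: esym (tensor_scale_pi c [:: (m, n)]).
have pureZr c m n : m *t (c *: n) = c *: (m *t n) :> tensor M N.
  by rewrite -pureZl; apply/tensor_piP; apply/TensorSym/TensorScale.
by split=> [m|n] c u v; rewrite ?(pureDl, pureDr) ?(pureZl, pureZr).
Qed.

Lemma tensor_sum x : x = \sum_(p <- repr x) p.1 *t p.2.
Proof.
rewrite -{1}[x]reprK; elim: (repr x) => [|[m n] s IHs]; first by rewrite big_nil.
by rewrite big_cons -IHs -tensor_piD.
Qed.

Lemma tlift_pi f s : bilin f ->
  tlift f (\pi_(tensor M N) s) = \sum_(p <- s) f p.1 p.2.
Proof.
case=> linr linl.
have linD (V W : lmodType k) (h : V -> W) : linear h -> {morph h : u v / u + v}.
  by move=> linh u v; have:= linh 1 u v; rewrite !scale1r.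
have lin0 (V W : lmodType k) (h : V -> W) : linear h -> h 0 = 0.
  by move=> /linD hD; apply: (addrI (h 0)); rewrite -hD !addr0.
have linZ (V W : lmodType k) (h : V -> W) c v : linear h -> h (c *: v) = c *: h v.
  by move=> linh; rewrite -[c *: v]addr0 linh lin0 ?addr0.
rewrite /tlift; move: (repr _) (tensor_eq_repr s) => r.
elim=> {r s} [s|s t _ ->|s t r _ -> _ ->||||||] //=.
- by move=> s s' t t' _ e _ e'; rewrite !big_cat e e'.
- by move=> s t; rewrite !big_cat /= addrC.
- by move=> m m' n; rewrite !big_cons big_nil !addr0 /= (linD _ _ _ (linl n)).
- by move=> m n n'; rewrite !big_cons big_nil !addr0 /= (linD _ _ _ (linr m)).
- move=> c m n; rewrite !big_cons big_nil !addr0 /= (linZ _ _ _ _ _ (linl n)).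
  by rewrite (linZ _ _ _ _ _ (linr m)).
- by move=> n; rewrite big_cons !big_nil addr0 /= (lin0 _ _ _ (linl n)).
Qed.

Lemma tlift_pure f m n : bilin f -> tlift f (m *t n) = f m n.
Proof. by move/tlift_pi=> ->; rewrite big_seq1. Qed.

Lemma tlift_linear f : bilin f -> linear (tlift f).
Proof.
move=> bf c x y; rewrite -[x]reprK -[y]reprK.
move: (repr x) (repr y) => s t.
have ->: c *: \pi_(tensor M N) s = \pi_(tensor M N) (scale_seq c s).
  exact: tensor_scale_pi.
rewrite -tensor_piD !tlift_pi // big_cat big_map scaler_sumr; congr (_ + _).
case: bf => _ linl; have lin0 n : f 0 n = 0.
  apply: (addrI (f 0 n)); have:= linl n 1 0 0.
  by rewrite !scale1r !addr0 => <-.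
by apply: eq_bigr => -[m n] _ /=; rewrite -[c *: m]addr0 linl lin0 addr0.
Qed.

Lemma tlift_unique (F : tensor M N -> L) : linear F ->
  F =1 tlift (fun m n => F (m *t n)).
Proof.
move=> linF x; pose FL : {linear tensor M N -> L} :=
  HB.pack F (GRing.isLinear.Build k (tensor M N) L *:%R F linF).
by rewrite {1}[x]tensor_sum -[F]/(FL : _ -> _) linear_sum.
Qed.

End TensorTheory.

(* The base ring, as a module over itself, is [k^o]. *)

Record is_algebra (k : comPzRingType) (A : lmodType k)
    (mu : A -> A -> A) (u : k^o -> A) : Prop := IsAlgebra {
  algebra_bilin : bilin mu;
  algebra_assoc : associative mu;
  algebra_unit_linear : linear u;
  algebra_mul1l : left_id (u 1) mu;
  algebra_mul1r : right_id (u 1) mu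
}.

Record is_coalgebra (k : comPzRingType) (C : lmodType k)
    (D : C -> tensor C C) (e : C -> k^o) : Prop := IsCoalgebra {
  coalgebra_linear : linear D;
  coalgebra_counit_linear : linear e;
  coalgebra_coassoc x :
    tassoc (tmap D id (D x)) = tmap id D (D x);
  coalgebra_counitl x :
    tlift (fun (a : k^o) (y : C) => (a : k) *: y) (tmap e id (D x)) = x;
  coalgebra_counitr x :
    tlift (fun (y : C) (a : k^o) => (a : k) *: y) (tmap id e (D x)) = x
}.

Record is_algebra_hom (k : comPzRingType) (A B : lmodType k)
    (muA : A -> A -> A) (uA : k^o -> A) (muB : B -> B -> B) (uB : k^o -> B)
    (f : A -> B) : Prop := IsAlgebraHom {
  algebra_hom_linear : linear f;
  algebra_hom_mul : {morph f : x y / muA x y >-> muB x y};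
  algebra_hom_unit : forall c, f (uA c) = uB c
}.

Definition tmul (k : comPzRingType) (A B : lmodType k)
    (muA : A -> A -> A) (muB : B -> B -> B) (x y : tensor A B) : tensor A B :=
  tlift (fun a b => tlift (fun a' b' => muA a a' *t muB b b') y) x.

Definition tunit (k : comPzRingType) (A B : lmodType k)
    (uA : k^o -> A) (uB : k^o -> B) (c : k^o) : tensor A B :=
  uA c *t uB 1.

Record is_bialgebra (k : comPzRingType) (H : lmodType k)
    (mu : H -> H -> H) (u : k^o -> H) (D : H -> tensor H H) (e : H -> k^o)
  : Prop := IsBialgebra {
  bialgebra_algebra : is_algebra mu u;
  bialgebra_coalgebra : is_coalgebra D e;
  bialgebra_comul_hom :
    is_algebra_hom mu u (tmul mu mu) (tunit u u) D;
  bialgebra_counit_hom :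
    is_algebra_hom mu u (fun a b : k^o => a * b) (fun c : k^o => c) e
}.

Section TensorAlgebra.
Variables (k : comPzRingType) (A B : lmodType k).
Variables (muA : A -> A -> A) (muB : B -> B -> B).
Hypotheses (bA : bilin muA) (bB : bilin muB).

Let bAB a b : bilin (fun a' b' => muA a a' *t muB b b' : tensor A B).
Proof.
case: (pure_bilin A B) => pr pl; split=> [a'|b'] c u v.
  by rewrite bB.1 pr.
by rewrite bA.1 pl.
Qed.

Lemma tmul_bilin_aux y :
  bilin (fun a b => tlift (fun a' b' => muA a a' *t muB b b') y : tensor A B).
Proof.
case: (pure_bilin A B) => pr pl.
split=> [a|b] c u v; elim/tensorW: y => s; rewrite !tlift_pi //;
  rewrite scaler_sumr -big_split; apply: eq_bigr => p _ /=.
  by rewrite bB.2 pr.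
by rewrite bA.2 pl.
Qed.

Lemma tmul_bilin : bilin (tmul muA muB).
Proof.
split=> [x|y] c u v; last by rewrite /tmul (tlift_linear (tmul_bilin_aux y)).
rewrite /tmul /tlift scaler_sumr -big_split; apply: eq_bigr => p _ /=.
exact: tlift_linear (bAB p.1 p.2) c u v.
Qed.

Lemma tmul_pure a b a' b' :
  tmul muA muB (a *t b) (a' *t b') = muA a a' *t muB b b'.
Proof. by rewrite /tmul tlift_pure ?tlift_pure //; apply: tmul_bilin_aux. Qed.

End TensorAlgebra.

Inductive letter (X : Type) : Type :=
| Var of X
| Brk of seq (letter X).

Arguments Var {X} x.
Arguments Brk {X} w.

HB.instance Definition _ (X : Type) := gen_eqMixin (letter X).
HB.instance Definition _ (X : Type) := gen_choiceMixin (letter X).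

(* The monoid of all bracketed words: words of nesting depth at most [n] form
   the [n]-th stage of the direct system, and every word has a finite depth. *)
Notation bword X := (seq (letter X)).

Section RotaBaxterWords.
Variable X : Type.
Implicit Types (u v w : bword X) (Y Z : set (bword X)) (n r : nat).

Local Open Scope classical_set_scope.

Definition free_monoid : set (bword X) := range (map (@Var X)).

Definition free_semigroup : set (bword X) := free_monoid `\ [::].

Definition brackets Z : set (bword X) := [set [:: Brk z] | z in Z].

Definition wprod Y Z : set (bword X) := [set u ++ v | u in Y & v in Z].

Definition wpow Y r : set (bword X) := iter r (wprod Y) [set [::]].

Definition Lambda Y Z : set (bword X) :=
  \bigcup_(r in [set r | (1 <= r)%N]) wpow (wprod Y (brackets Z)) r
  `|` \bigcup_r wprod (wpow (wprod Y (brackets Z)) r) Y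
  `|` \bigcup_(r in [set r | (1 <= r)%N]) wpow (wprod (brackets Z) Y) r
  `|` \bigcup_r wprod (wpow (wprod (brackets Z) Y) r) (brackets Z)
  `|` [set [::]].

Fixpoint rbw_stage n : set (bword X) :=
  if n is n'.+1 then Lambda free_semigroup (rbw_stage n') else free_monoid.

Definition rbw : set (bword X) := \bigcup_n rbw_stage n.

End RotaBaxterWords.

Arguments free_monoid X : clear implicits.
Arguments free_semigroup X : clear implicits.
Arguments rbw_stage X n : clear implicits.
Arguments rbw X : clear implicits.

Definition rbword (X : Type) : Type := {w : bword X | w \in rbw X}.

HB.instance Definition _ X := SubChoice.on (rbword X).

Section RotaBaxterWordsTheory.
Variable X : Type.
Implicit Types (l : letter X) (u v w : bword X) (Y Z : set (bword X)).

Local Open Scope classical_set_scope.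

Definition is_var l : bool := if l is Var _ then true else false.

Fixpoint ldepth l : nat :=
  if l is Brk w then (foldr (fun l' d => maxn (ldepth l') d) 0 w).+1 else 0.

(* The depth of a Rota-Baxter word, by [rbw_stageP]. *)
Definition depth w : nat := foldr (fun l d => maxn (ldepth l) d) 0 w.

Fixpoint rbw_letter l : bool :=
  if l is Brk w
  then all rbw_letter w && sorted [rel l l' | is_var l || is_var l'] w
  else true.

Definition rbwb w : bool :=
  all rbw_letter w && sorted [rel l l' | is_var l || is_var l'] w.

Let Q Z w := sorted [rel l l' | is_var l || is_var l'] w /\
  forall z, Brk z \in w -> Z z.

Let hvar w := if w is l :: _ then is_var l else true.
Let lvar w := if w is l :: w' then is_var (last l w') else true.

Lemma wprodA Y Z T : wprod Y (wprod Z T) = wprod (wprod Y Z) T.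
Proof.
apply/seteqP; split=> w.
  by move=> [y Yy] [_ [z Zz [t Tt <-]] <-]; exists (y ++ z); [exists y => //; exists z|exists t; rewrite ?catA].
by move=> [_ [y Yy [z Zz <-]]] [t Tt <-]; exists y => //; exists (z ++ t); rewrite ?catA //; exists z => //; exists t.
Qed.

Lemma wprod1 Y : wprod [set [::]] Y = Y.
Proof.
apply/seteqP; split=> w; first by move=> [_ -> [v Yv <-]].
by move=> Yw; exists [::] => //; exists w.
Qed.

Lemma wprodr1 Y : wprod Y [set [::]] = Y.
Proof.
apply/seteqP; split=> w; first by move=> [v Yv [_ -> <-]]; rewrite cats0.
by move=> Yw; exists w => //; exists [::]; rewrite ?cats0.
Qed.

Lemma wpow_shift Y Z r :
  wprod (wpow (wprod Y Z) r) Y = wprod Y (wpow (wprod Z Y) r).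
Proof.
elim: r => [|r IHr]; first by rewrite /= wprod1 wprodr1.
by rewrite /= -wprodA IHr -!wprodA.
Qed.

Lemma Lambda_sub Z w : Lambda (free_semigroup X) Z w -> Q Z w.
Proof.
set S := free_semigroup X.
have QS u : S u -> [/\ Q Z u, hvar u & lvar u].
  move=> [[s _ <-] _]; split; [|by case: s|]; last first.
    by case: s => // x s; rewrite /= last_map.
  split=> [|z]; last by elim: s => //= x s IHs; rewrite inE => /orP [/eqP|//].
  by case: s => //= x s; elim: s x => //= y s IHs _; apply: IHs.
have QZ u : brackets Z u -> Q Z u.
  by move=> [z Zz <-]; split=> // z'; rewrite inE => /eqP [->].
have Qcat u v : Q Z u -> Q Z v -> lvar u || hvar v -> Q Z (u ++ v).
  move=> [su Zu] [sv Zv] uv; split=> [|z]; last first.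
    by rewrite mem_cat => /orP [/Zu|/Zv].
  case: u su uv {Zu} => //= l u su; rewrite cat_path su /=.
  by case: v sv {Zv} => //= m v -> ->.
have hcat u v : hvar u -> hvar v -> hvar (u ++ v) by case: u.
have lcat u v : lvar u -> lvar v -> lvar (u ++ v).
  by case: u => //= l u; rewrite last_cat; case: v.
have QYZ r u : wpow (wprod S (brackets Z)) r u -> Q Z u /\ hvar u.
  elim: r u => [|r IHr] u /=; first by move->; split=> //; split.
  move=> [_ [y Sy [z Zz <-]] [v /IHr [Qv hv] <-]].
  have [Qy hy ly] := QS _ Sy; split; last first.
    by case: y Sy hy {Qy ly} => [[_ []]|].
  apply: (Qcat); rewrite ?hv ?orbT //.
  by apply: (Qcat); rewrite ?ly //; apply: (QZ).
have QZY r u : wpow (wprod (brackets Z) S) r u -> Q Z u /\ lvar u.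
  elim: r u => [|r IHr] u /=; first by move->; split=> //; split.
  move=> [_ [z Zz [y Sy <-]] [v /IHr [Qv lv] <-]].
  have [Qy hy ly] := QS _ Sy.
  have lzy : lvar (z ++ y).
    by case: y ly Sy {Qy hy} => [_ [_ []]//|l y]; case: z Zz => //= m z _;
       rewrite last_cat.
  split; last exact: (lcat).
  apply: (Qcat); rewrite ?lzy //.
  by apply: (Qcat); rewrite ?hy ?orbT //; apply: (QZ).
case=> [[[[]|]|]|].
- by move=> [r _ /QYZ []].
- move=> [r _ [u /QYZ [Qu _] [y /QS [Qy hy _] <-]]].
  by apply: (Qcat); rewrite ?hy ?orbT.
- by move=> [r _ /QZY []].
- move=> [r _ [u /QZY [Qu lu] [z /QZ Qz <-]]].
  by apply: (Qcat); rewrite ?lu.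
- by move->; split.
Qed.

Lemma free_semigroup_cons x w :
  free_monoid X w -> free_semigroup X (Var x :: w).
Proof. by move=> [s _ <-]; split=> //; exists (x :: s). Qed.

Lemma wprod_cons x Y w : wprod (free_semigroup X) Y w ->
  wprod (free_semigroup X) Y (Var x :: w).
Proof.
move=> [y Sy [z Yz <-]]; exists (Var x :: y); last by exists z.
by apply: free_semigroup_cons; case: Sy.
Qed.

Lemma Lambda_sup Z w : Q Z w -> Lambda (free_semigroup X) Z w.
Proof.
set S := free_semigroup X; set B := brackets Z.
elim: w => [|l w IHw] Qlw; first by right.
have Qw : Q Z w.
  case: Qlw => slw Zlw; split=> [|z zw].
    by case: w slw {IHw Zlw} => //= m w /andP [].
  by apply: Zlw; rewrite inE zw orbT.
case: l Qlw => [x|z] Qlw.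
  have S1 : S [:: Var x] by apply: free_semigroup_cons; exists [::].
  case: (IHw Qw) => [[[[]|]|]|].
  - move=> [[//|r] _ Yw]; left; left; left; left; exists r.+1 => //.
    by move: Yw; rewrite /= -!wprodA; apply: wprod_cons.
  - move=> [r _ Yw]; left; left; left; right; exists r => //.
    case: r Yw => [|r]; last by rewrite /= -!wprodA; apply: wprod_cons.
    by rewrite /= !wprod1 => -[Sw _]; apply: free_semigroup_cons.
  - move=> [r _ Yw]; left; left; left; right; exists r => //.
    by rewrite wpow_shift; exists [:: Var x] => //; exists w.
  - move=> [r _ Yw]; left; left; left; left; exists r.+1 => //=.
    rewrite -[wpow _ r]wprodr1.
    have -> : wprod (wprod S B) (wprod (wpow (wprod S B) r) [set [::]])
      = wprod S (wprod (wpow (wprod B S) r) B).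
      by rewrite wprodr1 -wprodA wpow_shift.
    by exists [:: Var x] => //; exists w.
  - move->; left; left; left; right; exists 0%N => //=.
    by rewrite wprod1.
have hw : hvar w by case: w Qlw {IHw Qw} => //= m w [/andP []].
have Bz : B [:: Brk z] by exists z => //; apply: Qlw.2; rewrite inE eqxx.
case: (IHw Qw) => [[[[]|]|]|].
- move=> [r _ Yw]; left; right; exists r => //; rewrite wpow_shift.
  by exists [:: Brk z] => //; exists w.
- move=> [r _ Yw]; left; left; right; exists r.+1 => //=.
  by rewrite -wprodA -wpow_shift; exists [:: Brk z] => //; exists w.
- by move=> [[//|r] _ [_ [_ [t _ <-] [y _ <-]] [v _ ew]]]; rewrite -ew in hw.
- move=> [[|r] _]; rewrite /= ?wprod1.
    by move=> [t _ ew]; rewrite -ew in hw.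
  by move=> [_ [_ [_ [t _ <-] [y _ <-]] [v _ <-]] [y' _ ew]]; rewrite -ew in hw.
- by move->; left; right; exists 0%N => //=; rewrite wprod1.
Qed.

Lemma depth_leP n w :
  (depth w <= n.+1)%N <-> forall z, Brk z \in w -> (depth z <= n)%N.
Proof.
elim: w => [|l w IHw]; first by split.
rewrite /= geq_max; split=> [/andP [ln /IHw wn] z|wn].
  by rewrite inE => /orP [/eqP el|/wn //]; move: ln; rewrite -el.
apply/andP; split; last by apply/IHw => z zw; apply: wn; rewrite inE zw orbT.
by case: l wn {IHw} => //= z wn; apply: (wn z); rewrite inE eqxx.
Qed.

Lemma all_rbw_letterP w :
  all rbw_letter w <-> forall z, Brk z \in w -> rbwb z.
Proof.
split=> [/allP wP z /wP //|wP]; apply/allP => -[//|z] /wP //.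
Qed.

Lemma rbw_stageP n w : rbw_stage X n w <-> rbwb w /\ (depth w <= n)%N.
Proof.
elim: n w => [|n IHn] w /=.
  split=> [[s _ <-]|[_]].
    split; last by elim: s => //= x s; rewrite max0n.
    rewrite /rbwb; apply/andP; split; first by elim: s.
    by case: s => //= x s; elim: s x => //= y s IHs _; apply: IHs.
  elim: w => [|[x|z] w IHw] /=; first by exists [::].
    by rewrite geq_max => /IHw [s _ <-]; exists (x :: s).
  by rewrite geq_max.
split=> [/Lambda_sub [sw Zw]|[/andP [aw sw] dw]].
  rewrite /rbwb sw andbT; split.
    by apply/all_rbw_letterP => z /Zw /IHn [].
  by apply/depth_leP => z /Zw /IHn [].
apply: Lambda_sup; split=> // z zw; apply/IHn; split.
  by move/all_rbw_letterP: aw; apply.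
by move/depth_leP: dw; apply.
Qed.

Lemma rbwP w : (w \in rbw X) = rbwb w.
Proof.
apply/idP/idP => [/set_mem [n _ /rbw_stageP [] //]|ww].
by apply/mem_set; exists (depth w) => //; apply/rbw_stageP.
Qed.

Lemma rbwb_brk w : rbwb [:: Brk w] = rbwb w.
Proof. by rewrite /rbwb /= !andbT. Qed.

Lemma rbw_nil : [::] \in rbw X.
Proof. by rewrite rbwP. Qed.

Lemma rbw_brk w : w \in rbw X -> [:: Brk w] \in rbw X.
Proof. by rewrite !rbwP rbwb_brk. Qed.

Lemma rbw_cat_var u v l m :
  rcons u l \in rbw X -> m :: v \in rbw X -> is_var l || is_var m ->
  rcons u l ++ m :: v \in rbw X.
Proof.
rewrite !rbwP /rbwb all_cat => /andP [-> su] /andP [-> sv] lm /=.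
case: u su => [|a u] /= su; first by rewrite lm.
by rewrite cat_path su last_rcons /= lm.
Qed.

End RotaBaxterWordsTheory.

Arguments is_var {X} l.

Definition FRB (k : comPzRingType) (X : Type) : Type := freemod k (rbword X).

HB.instance Definition _ k X := GRing.Lmodule.on (FRB k X).

Section FreeRotaBaxter.
Variables (k : comPzRingType) (lambda : k) (X : Type).
Local Notation H := (FRB k X).
Implicit Types (u v w : bword X).

(* Bracketed words that are not Rota-Baxter words never occur below; they are
   sent to [0] to make this map total. *)
Definition word_vec w : H :=
  if insub w is Some r then fbasis (r : rbword X) else 0.

Definition rb_one : H := word_vec [::].

Definition rb_op : H -> H := linext (fun r : rbword X => word_vec [:: Brk (val r)]).

(* [n] is a bound on the number of recursive calls, which decrease the sum of
   the depths of the two words: see [rb_word_mul_rec_stable]. When the last factor of the standard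
   decomposition of [u] and the first factor of that of [v] are not both
   brackets, the product is the concatenation. *)
Fixpoint rb_word_mul_rec (n : nat) u v : H :=
  if n is n'.+1 then
    match rev u, v with
    | Brk a :: u', Brk b :: v' =>
        linext (fun r : rbword X => word_vec (rev u' ++ val r ++ v'))
          (rb_op (rb_word_mul_rec n' [:: Brk a] b)
           + rb_op (rb_word_mul_rec n' a [:: Brk b])
           + lambda *: rb_op (rb_word_mul_rec n' a b))
    | _, _ => word_vec (u ++ v)
    end
  else 0.

Definition rb_word_mul u v : H := rb_word_mul_rec (depth u + depth v).+1 u v.

Definition rb_mul (f g : H) : H :=
  linext (fun r : rbword X =>
    linext (fun s : rbword X => rb_word_mul (val r) (val s)) g) f.

Definition rb_unit (c : k^o) : H := (c : k) *: rb_one.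

(* The alternating factorization of a word is its sequence of letters. *)
Fixpoint rb_coprod_letter (l : letter X) : tensor H H :=
  match l with
  | Var x => word_vec [:: Var x] *t rb_one + rb_one *t word_vec [:: Var x]
  | Brk w =>
      word_vec [:: Brk w] *t rb_one
      + tmap id rb_op
          (foldr (fun l' d => tmul rb_mul rb_mul (rb_coprod_letter l') d)
             (rb_one *t rb_one) w)
  end.

Definition rb_coprod_word w : tensor H H :=
  foldr (fun l d => tmul rb_mul rb_mul (rb_coprod_letter l) d)
    (rb_one *t rb_one) w.

Definition rb_coprod : H -> tensor H H :=
  linext (fun r : rbword X => rb_coprod_word (val r)).

Definition rb_counit : H -> k^o :=
  linext (fun r : rbword X => if val r == [::] then 1 else 0 : k^o).

Lemma word_vecE w (rw : w \in rbw X) :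
  word_vec w = fbasis (exist _ w rw : rbword X).
Proof. by rewrite /word_vec insubT. Qed.

Lemma word_vec_val (r : rbword X) : word_vec (val r) = fbasis r.
Proof. by rewrite /word_vec valK. Qed.

Lemma linext_word (M : lmodType k) (phi : bword X -> M) w : w \in rbw X ->
  linext (fun r : rbword X => phi (val r)) (word_vec w) = phi w.
Proof. by move=> rw; rewrite (word_vecE rw) linext_basis. Qed.

Lemma linext_id (f : H) : linext (fun r : rbword X => word_vec (val r)) f = f.
Proof.
rewrite [RHS](linext_unique (F := id)) //.
by congr linext; apply/funext => r; rewrite word_vec_val.
Qed.

Lemma rb_op_linear : linear rb_op.
Proof. exact: linext_linear. Qed.

Lemma rb_op_word w : w \in rbw X -> rb_op (word_vec w) = word_vec [:: Brk w].
Proof. exact: (linext_word (fun w => word_vec [:: Brk w])). Qed.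

Lemma rb_mul_bilin : bilin rb_mul.
Proof.
split=> [f|g]; last exact: linext_linear.
move=> c g h; rewrite /rb_mul /linext scaler_sumr -big_split.
by apply: eq_bigr => r _; rewrite [X in _ *: X]linext_linear scalerDr !scalerA mulrC.
Qed.

Lemma rb_mul_word u v : u \in rbw X -> v \in rbw X ->
  rb_mul (word_vec u) (word_vec v) = rb_word_mul u v.
Proof.
by move=> ru rv; rewrite /rb_mul (word_vecE ru) (word_vecE rv) !linext_basis.
Qed.

Lemma depth_brk (z : bword X) w : Brk z \in w -> (depth z < depth w)%N.
Proof.
case E: (depth w) => [|n] zw; last by apply: (iffLR (depth_leP n w)); rewrite ?E.
suff: (depth z < depth w)%N by rewrite E.
elim: w zw {E} => //= l w IHw; rewrite inE leq_max.
by case/orP=> [/eqP <- | /IHw ->]; rewrite ?leqnn ?orbT.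
Qed.

Lemma rb_word_mul_rec_stable n m u v :
    (depth u + depth v < n)%N -> (depth u + depth v < m)%N ->
  rb_word_mul_rec n u v = rb_word_mul_rec m u v.
Proof.
elim: n m u v => // n IHn [//|m] u v; rewrite !ltnS => ln lm /=.
case Eu: (rev u) => [//|[//|a] u']; case: v ln lm => [//|[//|b] v] ln lm.
have au : Brk a \in u by rewrite -mem_rev Eu mem_head.
have da := depth_brk au.
have db : (depth b < depth (Brk b :: v))%N by apply: depth_brk; rewrite mem_head.
have da1 : (depth [:: Brk a] <= depth u)%N by rewrite /= maxn0.
have db1 : (depth [:: Brk b] <= depth (Brk b :: v))%N by rewrite /= maxn0 leq_maxl.
have ltD i : (depth u + depth (Brk b :: v) <= i)%N ->
  [/\ (depth [:: Brk a] + depth b < i)%N, (depth a + depth [:: Brk b] < i)%N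
     & (depth a + depth b < i)%N].
  move=> li; split; apply: leq_trans li.
  - by rewrite -addnS leq_add.
  - by rewrite -addSn leq_add.
  - by rewrite -addSn leq_add // ltnW.
have [n1 n2 n3] := ltD n ln; have [m1 m2 m3] := ltD m lm.
by rewrite (IHn _ _ _ n1 m1) (IHn _ _ _ n2 m2) (IHn _ _ _ n3 m3).
Qed.

Lemma rb_word_mul_recS n u v (a b : bword X) :
  rb_word_mul_rec n.+1 (rcons u (Brk a)) (Brk b :: v) =
  linext (fun r : rbword X => word_vec (u ++ val r ++ v))
    (rb_op (rb_word_mul_rec n [:: Brk a] b)
     + rb_op (rb_word_mul_rec n a [:: Brk b])
     + lambda *: rb_op (rb_word_mul_rec n a b)).
Proof. by rewrite /= rev_rcons revK. Qed.

Lemma rb_word_mul_brk u v (a b : bword X) :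
  rb_word_mul (rcons u (Brk a)) (Brk b :: v) =
  linext (fun r : rbword X => word_vec (u ++ val r ++ v))
    (rb_op (rb_word_mul [:: Brk a] b) + rb_op (rb_word_mul a [:: Brk b])
     + lambda *: rb_op (rb_word_mul a b)).
Proof.
rewrite {1}/rb_word_mul; set n := (_ + _)%N.
have da : (depth a < depth (rcons u (Brk a)))%N.
  by apply: depth_brk; rewrite mem_rcons mem_head.
have db : (depth b < depth (Brk b :: v))%N by apply: depth_brk; rewrite mem_head.
have da1 : (depth [:: Brk a] <= depth (rcons u (Brk a)))%N by rewrite /= maxn0.
have db1 : (depth [:: Brk b] <= depth (Brk b :: v))%N by rewrite /= maxn0 leq_maxl.
have e1 : (depth [:: Brk a] + depth b < n)%N by rewrite -addnS leq_add.
have e2 : (depth a + depth [:: Brk b] < n)%N by rewrite -addSn leq_add.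
have e3 : (depth a + depth b < n)%N by rewrite -addSn leq_add // ltnW.
rewrite rb_word_mul_recS /rb_word_mul (rb_word_mul_rec_stable e1 (ltnSn _)).
by rewrite (rb_word_mul_rec_stable e2 (ltnSn _)) (rb_word_mul_rec_stable e3 (ltnSn _)).
Qed.

Lemma rb_word_mul_cat u v :
    (forall u' a v' b, u = rcons u' (Brk a) -> v = Brk b :: v' -> False) ->
  rb_word_mul u v = word_vec (u ++ v).
Proof.
move=> nbrk; rewrite /rb_word_mul /=.
case Eu: (rev u) => [|[x|a] u'] //; case: v nbrk => [|[y|b] v] nbrk //.
have Eu' : u = rcons (rev u') (Brk a) by rewrite -rev_cons -Eu revK.
by case: (nbrk _ _ _ _ Eu' erefl).
Qed.

Lemma rb_mul1l : left_id rb_one rb_mul.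
Proof.
move=> f; rewrite -[RHS]linext_id /rb_mul /rb_one (word_vecE (rbw_nil X)).
by rewrite linext_basis.
Qed.

Lemma rb_mul1r : right_id rb_one rb_mul.
Proof.
move=> f; rewrite -[RHS]linext_id /rb_mul /rb_one (word_vecE (rbw_nil X)).
congr linext; apply/funext => r; rewrite linext_basis.
by rewrite rb_word_mul_cat ?cats0.
Qed.

(* The clause of the definition for two brackets, extended bilinearly. *)
Lemma rb_mul_op (f g : H) :
  rb_mul (rb_op f) (rb_op g) =
  rb_op (rb_mul (rb_op f) g) + rb_op (rb_mul f (rb_op g))
  + lambda *: rb_op (rb_mul f g).
Proof.
have [mr ml] := rb_mul_bilin; have opl := rb_op_linear.
have rearr (c : k) (x y z x' y' z' : H) :
    c *: x + x' + (c *: y + y') + lambda *: (c *: z + z') =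
    c *: (x + y + lambda *: z) + (x' + y' + lambda *: z').
  rewrite [lambda *: (_ + _)]scalerDr scalerA mulrC -scalerA.
  by rewrite [X in X + _ = _]addrACA [LHS]addrACA !scalerDr.
pose R f g : H := rb_op (rb_mul (rb_op f) g) + rb_op (rb_mul f (rb_op g))
  + lambda *: rb_op (rb_mul f g).
have linRl g' : linear (R^~ g') by move=> c x y; rewrite /R !(opl, ml) rearr.
have linRr f' : linear (R f') by move=> c x y; rewrite /R !(opl, mr) rearr.
have linLl g' : linear (fun f' => rb_mul (rb_op f') (rb_op g')).
  by move=> c x y; rewrite opl ml.
have linLr f' : linear (fun g' => rb_mul (rb_op f') (rb_op g')).
  by move=> c x y; rewrite opl mr.
apply: (freemod_linear_ext (linLl g) (linRl g)) => -[u ru] /=.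
apply: (freemod_linear_ext (linLr _) (linRr _)) => -[v rv] /=.
rewrite /R -!word_vecE !rb_op_word // !rb_mul_word ?rbw_brk //.
by rewrite -[[:: Brk u]]/(rcons [::] (Brk u)) rb_word_mul_brk;
   under eq_fun do rewrite cats0; apply: linext_id.
Qed.

(* With [a] the last and [b] the first factor of the standard decompositions of
   the two words, this is the definition of the product in general. *)
Lemma rb_mul_factors u v (a b : bword X) :
    u ++ a \in rbw X -> b ++ v \in rbw X ->
    free_semigroup X a \/ brackets (rbw X) a ->
    free_semigroup X b \/ brackets (rbw X) b ->
  rb_mul (word_vec (u ++ a)) (word_vec (b ++ v)) =
  linext (fun r : rbword X => word_vec (u ++ val r ++ v))
    (rb_mul (word_vec a) (word_vec b)).
Proof.
have blk w : free_semigroup X w \/ brackets (rbw X) w ->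
    [/\ w \in rbw X, w != [::] & all is_var w \/ exists z, w = [:: Brk z]].
  case=> [[Mw w0]|[z Zz <-]]; last first.
    by split=> //; [apply/rbw_brk/mem_set | right; exists z].
  split; first by apply/mem_set; exists 0%N.
    by apply/eqP.
  by left; case: Mw => s _ <-; elim: s.
move=> rua rbv /blk [ra a0 va] /blk [rb b0 vb].
rewrite !rb_mul_word //.
have cat_case : (all is_var a \/ all is_var b) ->
    rb_word_mul (u ++ a) (b ++ v) =
    linext (fun r : rbword X => word_vec (u ++ val r ++ v)) (rb_word_mul a b).
  move=> vab; rewrite !rb_word_mul_cat; last 2 first.
  - move=> a' x b' y ea eb; case: vab.
      by rewrite ea all_rcons.
    by rewrite eb.
  - move=> a' x b' y ea eb; case: vab => [va'|vb'].
      case/lastP: a a0 va' ea {rua ra va} => // a l _.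
      by rewrite all_rcons -rcons_cat => /andP [vl _] /rcons_inj [_ el]; rewrite el in vl.
    by case: b b0 vb' eb {rbv rb vb} => // l b _ /= /andP [vl _] [el _]; rewrite el in vl.
  have rab : a ++ b \in rbw X.
    case/lastP: a a0 ra vab {rua va} => // a l _ ra vab.
    case: b b0 rb vab {rbv vb} => // m b _ rb vab.
    by apply: rbw_cat_var => //; case: vab; rewrite ?all_rcons /= => /andP [->];
       rewrite ?orbT.
  by rewrite (linext_word (fun w => word_vec (u ++ w ++ v))) ?catA // -!catA.
case: va => [va|[z ez]]; first by apply: cat_case; left.
case: vb => [vb|[t et]]; first by apply: cat_case; right.
rewrite ez et cats1 -[[:: Brk z]]/(rcons [::] (Brk z)) !rb_word_mul_brk.
by under [X in _ = linext _ (linext X _)]eq_fun do rewrite cats0; rewrite linext_id.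
Qed.

Lemma rb_coprod_linear : linear rb_coprod.
Proof. exact: linext_linear. Qed.

Lemma rb_coprod_word_vec w :
  w \in rbw X -> rb_coprod (word_vec w) = rb_coprod_word w.
Proof. exact: (linext_word rb_coprod_word). Qed.

Lemma rb_coprod1 : rb_coprod rb_one = rb_one *t rb_one.
Proof. by rewrite rb_coprod_word_vec ?rbw_nil. Qed.

Let tmul11 (x : tensor H H) : tmul rb_mul rb_mul x (rb_one *t rb_one) = x.
Proof.
have [_ tl] := tmul_bilin rb_mul_bilin rb_mul_bilin.
rewrite (tlift_unique (tl _)) [RHS](tlift_unique (F := id)) //.
by apply: eq_bigr => p _; rewrite tmul_pure ?rb_mul1r //; apply: rb_mul_bilin.
Qed.

Lemma rb_coprod_var x : rb_coprod (word_vec [:: Var x]) =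
  word_vec [:: Var x] *t rb_one + rb_one *t word_vec [:: Var x].
Proof. by rewrite rb_coprod_word_vec ?rbwP //= tmul11. Qed.

Lemma rb_coprod_op (f : H) :
  rb_coprod (rb_op f) = rb_op f *t rb_one + tmap id rb_op (rb_coprod f).
Proof.
have [pr pl] := pure_bilin H H.
have bop : bilin (fun f g : H => f *t rb_op g).
  by split=> [a|b] c x y; rewrite ?rb_op_linear (pr, pl).
have opl := rb_op_linear; have col := rb_coprod_linear.
have tml := tlift_linear bop.
pose R f : tensor H H := rb_op f *t rb_one + tmap id rb_op (rb_coprod f).
have linL : linear (fun f => rb_coprod (rb_op f)) by move=> c x y; rewrite opl col.
have linR : linear R.
  by move=> c x y; rewrite /R opl col pl [X in _ + X]tml scalerDr addrACA.
apply: (freemod_linear_ext linL linR) => -[w rw]; rewrite /R /=.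
rewrite -word_vecE rb_op_word // !rb_coprod_word_vec ?rbw_brk //.
by rewrite [LHS]tmul11.
Qed.

Lemma rb_coprod_cons l w : l :: w \in rbw X ->
  rb_coprod (word_vec (l :: w)) =
  tmul rb_mul rb_mul (rb_coprod (word_vec [:: l])) (rb_coprod (word_vec w)).
Proof.
rewrite rbwP /rbwb /= => /andP [/andP [rl aw] sw].
have sw' : sorted [rel l l' | is_var l || is_var l'] w := path_sorted sw.
rewrite !rb_coprod_word_vec ?rbwP /rbwb /= ?rl ?aw ?sw' ?sw //.
by rewrite tmul11.
Qed.

End FreeRotaBaxter.

Arguments rb_mul {k} lambda {X} f g.
Arguments rb_coprod {k} lambda {X} _.
Arguments rb_unit k X c : clear implicits.
Arguments rb_counit k X _ : clear implicits.

(* Main.v *)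
Require Import Defs.
From mathcomp Require Import all_boot all_algebra.
From mathcomp.classical Require Import boolp classical_sets functions.

Set Implicit Arguments.
Unset Strict Implicit.
Unset Printing Implicit Defensive.

Import GRing.Theory.
Local Open Scope ring_scope.

(** Three facts have to be proved: the product is associative, and the coproduct
    and the counit are multiplicative. All three assert that a linear map [phi]
    from [H] to some associative algebra is multiplicative; for associativity
    [phi] is left multiplication, with values in the maps [H -> H] under
    composition. They are instances of one criterion, [rb_mul_morphism]: the
    product of two words is their concatenation unless a bracket meets a
    bracket, so it suffices that [phi] turns every concatenation that is a
    Rota-Baxter word into a product, and that multiplicativity on the pairs
    [(P f, g)], [(f, P g)], [(f, g)] implies it on [(P f, P g)]. By the
    Rota-Baxter identity the last condition is a computation in each case:
    - for left multiplication, it is the computation that the Rota-Baxter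
      identity is compatible with associativity ([rota_baxter_assoc]), inside an
      induction on the third factor ([rb_op_assoc]);
    - for the coproduct, write [Q] for [id (x) P], which is again a Rota-Baxter
      operator of weight [lambda], and commutes with multiplication by
      [f (x) 1] on either side. Expanding the product of
      [D (P f) = P f (x) 1 + Q (D f)] and [D (P g) = P g (x) 1 + Q (D g)] gives
      [P f P g (x) 1 + Q (D (P f g + f P g + lambda f g))], which is the
      coproduct of [P f P g];
    - the counit vanishes on the image of [P], which contains [P f P g].

    Coassociativity and the counit laws then equate two algebra morphisms on
    [H]. Such morphisms agree as soon as they agree on [1] and on the variables,
    and agree at [P f] whenever they agree at [f] ([rb_morphism_ext]). The
    formula [D (P f) = P f (x) 1 + Q (D f)] provides this last step: it splits
    each side at [P f] into a term that is the same on both sides and an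
    operator applied to that side at [f]. *)

(** * Linear maps *)

Section Linearity.
Variables (k : comPzRingType) (M N L : lmodType k).

Lemma lin_add (F : M -> N) : linear F -> {morph F : x y / x + y}.
Proof. by move=> linF x y; have:= linF 1 x y; rewrite !scale1r. Qed.

Lemma lin_zero (F : M -> N) : linear F -> F 0 = 0.
Proof. by move=> linF; apply: (addrI (F 0)); rewrite -lin_add // !addr0. Qed.

Lemma lin_scale (F : M -> N) c : linear F -> {morph F : x / c *: x}.
Proof. by move=> linF x; rewrite -[c *: x]addr0 linF lin_zero // addr0. Qed.

Lemma comp_linear (F : M -> N) (G : N -> L) :
  linear F -> linear G -> linear (fun x => G (F x)).
Proof. by move=> linF linG c x y; rewrite linF linG. Qed.

Lemma add_linear (F G : M -> N) :
  linear F -> linear G -> linear (fun x => F x + G x).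
Proof.
by move=> linF linG c x y; rewrite linF linG scalerDr addrACA.
Qed.

Lemma scale_linear c (F : M -> N) : linear F -> linear (fun x => c *: F x).
Proof. by move=> linF d x y; rewrite linF scalerDr !scalerA mulrC. Qed.

Lemma id_linear : linear (@id M).
Proof. by []. Qed.

End Linearity.

(** * Concatenation of Rota-Baxter words *)

Section Words.
Variable X : Type.
Implicit Types (u v w : bword X) (a b : bword X).

(** The empty word counts as free at both ends: nothing obstructs concatenation
    with it. *)
Definition starts_free w := if w is l :: _ then is_var l else true.
Definition ends_free w := starts_free (rev w).

Lemma ends_free_rcons w l : ends_free (rcons w l) = is_var l.
Proof. by rewrite /ends_free rev_rcons. Qed.

Lemma rbw_cat u v : u ++ v \in rbw X ->
  [/\ u \in rbw X, v \in rbw X & ends_free u || starts_free v].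
Proof.
rewrite !rbwP /rbwb all_cat => /andP [/andP [-> ->]] /=.
case/lastP: u => [|u l]; first by move=> ->.
case: v => [|m v]; first by rewrite cats0 => ->; rewrite orbT.
rewrite ends_free_rcons /=; case: u => [|l' u] /=.
  by move=> /andP [-> ->].
by rewrite cat_path rcons_path last_rcons /= => /and3P [-> -> ->].
Qed.

Lemma cat_rbw u v : u \in rbw X -> v \in rbw X -> ends_free u || starts_free v ->
  u ++ v \in rbw X.
Proof.
case/lastP: u => [//|u l]; case: v => [|m v]; first by rewrite cats0.
by rewrite ends_free_rcons; apply: rbw_cat_var.
Qed.

Lemma ends_free_cat_cons u l v : ends_free (u ++ l :: v) = ends_free (l :: v).
Proof. by rewrite lastI -rcons_cat !ends_free_rcons. Qed.

Variant junction_spec u v : Prop :=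
| FreeJunction of ends_free u || starts_free v
| BracketJunction u' a v' b of u = u' ++ [:: Brk a] & v = Brk b :: v'.

Lemma junctionP u v : junction_spec u v.
Proof.
case/lastP: u => [|u [x|a]]; try by left; rewrite ?ends_free_rcons.
case: v => [|[y|b] v]; try by left; rewrite orbT.
by rewrite -cats1; apply: (BracketJunction erefl erefl).
Qed.

Lemma rbw_brk_inv a : [:: Brk a] \in rbw X -> a \in rbw X.
Proof. by rewrite !rbwP rbwb_brk. Qed.

Lemma depth_bracket a : depth [:: Brk a] = (depth a).+1.
Proof. exact: maxn0. Qed.

Lemma depth_brk_last u a : (depth [:: Brk a] <= depth (u ++ [:: Brk a]))%N.
Proof.
by rewrite depth_bracket; apply: depth_brk; rewrite mem_cat mem_head orbT.
Qed.

Lemma depth_brk_head v b : (depth [:: Brk b] <= depth (Brk b :: v))%N.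
Proof. by rewrite depth_bracket leq_maxl. Qed.

End Words.

(** * A criterion for multiplicativity *)

Section Product.
Variables (k : comPzRingType) (lambda : k) (X : Type).
Local Notation H := (FRB k X).
Local Notation W := (word_vec k).
Local Notation P := (@rb_op k X).
Local Notation "f *r g" := (rb_mul lambda f g) (at level 40, left associativity).
Implicit Types (f g h : H) (u v w a b : bword X).

Lemma word_linear_ext (M : lmodType k) (F G : H -> M) : linear F -> linear G ->
  (forall w, w \in rbw X -> F (W w) = G (W w)) -> F =1 G.
Proof.
move=> linF linG FG; apply: (freemod_linear_ext linF linG) => -[w rw].
by rewrite -word_vecE FG.
Qed.

(** This is why [rb_mul_free] holds for all bracketed words: when a factor is
    not a Rota-Baxter word, neither is the concatenation, and both sides are
    [0]. *)
Lemma word_vec_out w : w \notin rbw X -> W w = 0 :> H.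
Proof. by move=> rw; rewrite /word_vec insubN. Qed.

Lemma rb_mull_linear g : linear (fun f => f *r g).
Proof. by apply: (rb_mul_bilin lambda X).2. Qed.

Lemma rb_mulr_linear f : linear (fun g => f *r g).
Proof. by apply: (rb_mul_bilin lambda X).1. Qed.

Lemma rb_mulZl c f g : (c *: f) *r g = c *: (f *r g).
Proof. exact: (lin_scale _ (rb_mull_linear g)). Qed.

Lemma rb_mulZr c f g : f *r (c *: g) = c *: (f *r g).
Proof. exact: (lin_scale _ (rb_mulr_linear f)). Qed.

Lemma rb_mul0l g : 0 *r g = 0.
Proof. exact: (lin_zero (rb_mull_linear g)). Qed.

Lemma rb_mul0r f : f *r 0 = 0.
Proof. exact: (lin_zero (rb_mulr_linear f)). Qed.

Lemma rb_opD f g : P (f + g) = P f + P g.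
Proof. exact: (lin_add (@rb_op_linear k X)). Qed.

Lemma rb_opZ c f : P (c *: f) = c *: P f.
Proof. exact: (lin_scale _ (@rb_op_linear k X)). Qed.

Lemma rb_mul_free u v : ends_free u || starts_free v -> W u *r W v = W (u ++ v).
Proof.
move=> uv; have [ru|ru] := boolP (u \in rbw X); last first.
  rewrite word_vec_out // rb_mul0l word_vec_out //.
  by apply: contra ru => /rbw_cat [].
have [rv|rv] := boolP (v \in rbw X); last first.
  rewrite [W v]word_vec_out // rb_mul0r word_vec_out //.
  by apply: contra rv => /rbw_cat [].
rewrite rb_mul_word // rb_word_mul_cat // => u' a v' b eu ev.
by move: uv; rewrite eu ev ends_free_rcons.
Qed.

Definition rb_plug u v : H -> H :=
  linext (fun r : rbword X => W (u ++ val r ++ v)).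

Lemma rb_plug_linear u v : linear (rb_plug u v).
Proof. exact: linext_linear. Qed.

Lemma rb_plug_word u v w : w \in rbw X -> rb_plug u v (W w) = W (u ++ w ++ v).
Proof. exact: (linext_word (fun w => word_vec k (u ++ w ++ v))). Qed.

Lemma rb_mul_bracket u v a b :
    u ++ [:: Brk a] \in rbw X -> Brk b :: v \in rbw X ->
  W (u ++ [:: Brk a]) *r W (Brk b :: v) =
  rb_plug u v (W [:: Brk a] *r W [:: Brk b]).
Proof.
move=> rua rbv; apply: (@rb_mul_factors _ _ _ u v [:: Brk a] [:: Brk b]) => //.
  by have [_ /rbw_brk_inv ra _] := rbw_cat rua; right; exists a => //; apply/set_mem.
have [/rbw_brk_inv rb _ _] := @rbw_cat X [:: Brk b] v rbv.
by right; exists b => //; apply/set_mem.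
Qed.

(** Naming the argument of [P] in the Rota-Baxter identity makes it visible that
    [P f *r P g] lies in the image of [P], so that it can be treated as a
    combination of brackets. *)
Definition rb_shuffle f g := P f *r g + f *r P g + lambda *: (f *r g).

Lemma rb_op_shuffle f g : P f *r P g = P (rb_shuffle f g).
Proof. by rewrite rb_mul_op !rb_opD rb_opZ. Qed.

(** If a bracket meets a bracket, the words are [u' [a]] and [[b] v'] and their
    product is [u' z v'] with [z = [a] *r [b]] a combination of brackets; as
    [phi] is multiplicative on concatenations, only [phi z] matters. The
    induction is on the sum of the depths, which drops when either bracket is
    opened. Linearity of [mulA] on the right is only asked for multipliers in
    the image of [phi], so that composition of maps [H -> H] is covered. *)
Lemma rb_mul_morphism (A : lmodType k) (mulA : A -> A -> A) (phi : H -> A) :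
    associative mulA -> (forall x, linear (mulA^~ x)) ->
    (forall f, linear (mulA (phi f))) -> linear phi ->
    (forall u v, u ++ v \in rbw X ->
       phi (W (u ++ v)) = mulA (phi (W u)) (phi (W v))) ->
    (forall f g,
       phi (P f *r g) = mulA (phi (P f)) (phi g) ->
       phi (f *r P g) = mulA (phi f) (phi (P g)) ->
       phi (f *r g) = mulA (phi f) (phi g) ->
       phi (P f *r P g) = mulA (phi (P f)) (phi (P g))) ->
  {morph phi : f g / f *r g >-> mulA f g}.
Proof.
move=> mA linl linr linphi phi_cat phi_op f g.
have linR f' : linear (fun g' => mulA (phi f') (phi g')).
  exact: comp_linear linphi (linr f').
have linL g' : linear (fun f' => mulA (phi f') (phi g')).
  exact: comp_linear linphi (linl _).
have linmulR f' : linear (fun g' => phi (f' *r g')).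
  exact: comp_linear (rb_mulr_linear f') linphi.
have linmulL g' : linear (fun f' => phi (f' *r g')).
  exact: comp_linear (rb_mull_linear g') linphi.
apply: (word_linear_ext (linmulR f) (linR f)) => v rv {g}.
apply: (word_linear_ext (linmulL _) (linL _)) => u ru {f}.
move: {2}_.+1 (ltnSn (depth u + depth v)%N) => n.
elim: n u v ru rv => // n IHn u v ru rv; rewrite ltnS => le_n.
case: (junctionP u v) => [uv|u' a v' b eu ev].
  by rewrite rb_mul_free // phi_cat // cat_rbw.
have rua : u' ++ [:: Brk a] \in rbw X by rewrite -eu.
have rbv : [:: Brk b] ++ v' \in rbw X by rewrite /= -ev.
have [ru' rBa lu'] := rbw_cat rua; have [rBb rv' hv'] := rbw_cat rbv.
have [ra rb] := (rbw_brk_inv rBa, rbw_brk_inv rBb).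
rewrite orbF in lu'; rewrite orFb in hv'.
have da := depth_brk_last u' a; have db := depth_brk_head v' b.
have dm : (depth [:: Brk a] + depth [:: Brk b] <= n)%N.
  by apply: leq_trans le_n; rewrite eu ev leq_add.
rewrite !depth_bracket addSn in dm.
have phiPab: phi (P (W a) *r P (W b)) = mulA (phi (P (W a))) (phi (P (W b))).
  apply: phi_op; rewrite ?rb_op_word //; apply: IHn => //.
  - by rewrite depth_bracket addSnnS.
  - by apply: ltn_trans dm; rewrite addnS.
rewrite eu ev rb_mul_bracket // -!rb_op_word //.
have plugE h : phi (rb_plug u' v' (P h)) =
    mulA (phi (W u')) (mulA (phi (P h)) (phi (W v'))).
  have opl := @rb_op_linear k X.
  have linG : linear (fun h => mulA (phi (W u')) (mulA (phi (P h)) (phi (W v')))).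
    exact: comp_linear (comp_linear opl (linL _)) (linr _).
  have linF : linear (fun h => phi (rb_plug u' v' (P h))).
    exact: comp_linear opl (comp_linear (@rb_plug_linear u' v') linphi).
  apply: (word_linear_ext linF linG) => z rz.
  rewrite rb_op_word // rb_plug_word ?rbw_brk //.
  have rzv : [:: Brk z] ++ v' \in rbw X by rewrite cat_rbw ?rbw_brk ?hv' ?orbT.
  by rewrite !phi_cat // cat_rbw ?lu'.
rewrite rb_op_shuffle plugE -rb_op_shuffle phiPab !mA -mA.
by rewrite (phi_cat _ _ rua) (phi_cat [:: Brk b] v' rbv) -!rb_op_word.
Qed.

End Product.

(** * Associativity of the product *)

Section RotaBaxterOperators.
Variables (k : comPzRingType) (lambda : k) (A : lmodType k).
Variables (mul : A -> A -> A) (P : A -> A).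
Local Notation "f *r g" := (mul f g) (at level 40, left associativity).
Hypothesis mul_bilin : bilin mul.
Hypothesis P_rb : forall f g,
  P f *r P g = P (P f *r g + f *r P g + lambda *: (f *r g)).

(** Both bracketings of [P f P g P h] lie in the image of [P] by two uses of the
    identity; the arguments of [P] are sums of seven products in which at least
    one of the three operators has been removed, and these match in pairs. The
    first three hypotheses are for all [e] because they are the induction
    hypotheses that [rb_mul_morphism] supplies for left multiplication. *)
Lemma rota_baxter_assoc f g h :
    (forall e, (P f *r g) *r e = P f *r (g *r e)) ->
    (forall e, (f *r P g) *r e = f *r (P g *r e)) ->
    (forall e, (f *r g) *r e = f *r (g *r e)) ->
    (P f *r P g) *r h = P f *r (P g *r h) ->
  (P f *r P g) *r P h = P f *r (P g *r P h).
Proof.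
move=> Pfg fPg fg PfPgh; have [mulr mull] := mul_bilin.
have mulDr x := lin_add (mulr x); have mulDl x := lin_add (mull x).
have mulZr c x := lin_scale c (mulr x); have mulZl c x := lin_scale c (mull x).
have Eq := P_rb f g; set q := (X in P f *r P g = P X) in Eq.
have Er := P_rb g h; set r := (X in P g *r P h = P X) in Er.
rewrite Eq Er (P_rb q) (P_rb f) -Eq -Er PfPgh; congr (P _).
rewrite /q /r {q r Eq Er} !(mulDl, mulDr, mulZl, mulZr).
rewrite !(Pfg, fPg, fg) !scalerDr !addrA.
by rewrite [LHS](+%R.[ACl 1*2*5*3*6*4*7]).
Qed.

End RotaBaxterOperators.

Section Associativity.
Variables (k : comPzRingType) (lambda : k) (X : Type).
Local Notation H := (FRB k X).
Local Notation W := (word_vec k).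
Local Notation P := (@rb_op k X).
Local Notation "f *r g" := (rb_mul lambda f g) (at level 40, left associativity).
Implicit Types (f g h : H) (u v w a b : bword X).

(** The criterion's condition on concatenations, for left multiplication: the
    junction of [v] and [f] is not affected by [u], since [v] keeps the type of
    its first letter when its last bracket is multiplied by a bracket. *)
Lemma rb_mul_cat_assoc u v f :
  u ++ v \in rbw X -> W (u ++ v) *r f = W u *r (W v *r f).
Proof.
move=> ruv; have [ru rv uv] := rbw_cat ruv.
have linR := comp_linear (rb_mulr_linear lambda (W v)) (rb_mulr_linear lambda (W u)).
apply: (word_linear_ext (rb_mulr_linear lambda (W (u ++ v))) linR) => w rw {f linR}.
case: (junctionP v w) => [vw|v' b w' c ev ew].
  rewrite [W v *r _]rb_mul_free //; case: v ruv rv uv vw => [|m v] ruv rv uv vw.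
    by rewrite !cats0.
  by rewrite !rb_mul_free ?ends_free_cat_cons ?catA.
rewrite ew in rw *; rewrite ev in ruv rv uv *.
have [rBc _ hw'] := @rbw_cat _ [:: Brk c] w' rw.
rewrite catA !rb_mul_bracket //; last by rewrite -catA.
(* The product of the two brackets is some [P q]: only words [[z]] occur in it. *)
rewrite -(rb_op_word k (rbw_brk_inv rBc)); have [_ rBb lv'] := rbw_cat rv.
rewrite -(rb_op_word k (rbw_brk_inv rBb)) rb_op_shuffle.
move: (rb_shuffle _ _ _) => q.
have opl := @rb_op_linear k X.
have linL := comp_linear opl (@rb_plug_linear k X (u ++ v') w').
have linR := comp_linear (comp_linear opl (@rb_plug_linear k X v' w'))
  (rb_mulr_linear lambda (W u)).
apply: (word_linear_ext linL linR) => z rz.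
rewrite rb_op_word // !rb_plug_word ?rbw_brk // rb_mul_free -?catA //.
by case: (v') uv.
Qed.

Lemma rb_op_mul_free f w : starts_free w ->
  P f *r W w = rb_plug [::] w (P f).
Proof.
move=> hw; have opl := @rb_op_linear k X.
have linL := comp_linear opl (rb_mull_linear lambda (W w)).
have linR := comp_linear opl (@rb_plug_linear k X [::] w).
apply: (word_linear_ext linL linR) => a ra.
by rewrite rb_op_word // rb_mul_free ?hw ?orbT // rb_plug_word ?rbw_brk.
Qed.

(** A factor that does not begin with a bracket is simply appended, so it can be
    moved across the parentheses. *)
Lemma rb_op2_mul_free f g w : starts_free w ->
  (P f *r P g) *r W w = P f *r (P g *r W w).
Proof.
move=> hw; have [rw|rw] := boolP (w \in rbw X); last first.
  by rewrite word_vec_out // !rb_mul0r.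
rewrite rb_op_shuffle rb_op_mul_free // -rb_op_shuffle.
have opl := @rb_op_linear k X; have plugl := @rb_plug_linear k X [::] w.
have linL f' : linear (fun g => rb_plug [::] w (P f' *r P g)).
  exact: comp_linear (comp_linear opl (rb_mulr_linear _ _)) plugl.
have linR f' : linear (fun g => P f' *r (P g *r W w)).
  exact: comp_linear (comp_linear opl (rb_mull_linear _ _)) (rb_mulr_linear _ _).
apply: (word_linear_ext (linL f) (linR f)) => b rb {g linL linR}.
have linL := comp_linear (comp_linear opl (rb_mull_linear lambda (P (W b)))) plugl.
have linR := comp_linear opl (rb_mull_linear lambda (P (W b) *r W w)).
apply: (word_linear_ext linL linR) => a ra {f linL linR}.
rewrite !rb_op_word // [W [:: Brk b] *r _]rb_mul_free ?hw ?orbT //.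
have rbw' : [:: Brk b] ++ w \in rbw X by rewrite cat_rbw ?rbw_brk ?hw ?orbT.
by rewrite [RHS](@rb_mul_bracket _ _ _ [::]) //; apply: rbw_brk.
Qed.

(** A third factor [[c] w] is [[c] *r w] with [w] appended at the end, which
    reduces the claim to the third factor [[c]]; there the Rota-Baxter
    computation needs the claim for [c], which has smaller depth. *)
Lemma rb_op_assoc f g :
  (forall e, (P f *r g) *r e = P f *r (g *r e)) ->
  (forall e, (f *r P g) *r e = f *r (P g *r e)) ->
  (forall e, (f *r g) *r e = f *r (g *r e)) ->
  forall e, (P f *r P g) *r e = P f *r (P g *r e).
Proof.
move=> Pfg fPg fg e.
have linR := comp_linear (rb_mulr_linear lambda (P g)) (rb_mulr_linear lambda (P f)).
apply: (word_linear_ext (rb_mulr_linear lambda _) linR) => w rw {e linR}.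
move: {2}_.+1 (ltnSn (depth w)) => n; elim: n w rw => // n IHn w rw.
case: w rw => [|[x|c] w] rw; rewrite ltnS => le_n; try exact: rb_op2_mul_free.
have [rBc rw' hw] := @rbw_cat _ [:: Brk c] w rw; rewrite orFb in hw.
have rc := rbw_brk_inv rBc.
have -> : W (Brk c :: w) = P (W c) *r W w.
  by rewrite rb_op_word // rb_mul_free ?hw ?orbT.
have opE f' g' : exists q, P f' *r P g' = P q by eexists; apply: rb_op_shuffle.
have [q Eq] := opE f g; have [r Er] := opE g (W c).
have lhsE : P f *r P g *r (P (W c) *r W w) = P f *r P g *r P (W c) *r W w.
  by rewrite Eq (rb_op2_mul_free q (W c) hw).
have rhsE : P f *r (P g *r (P (W c) *r W w)) = P f *r (P g *r P (W c)) *r W w.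
  by rewrite -(rb_op2_mul_free g (W c) hw) Er (rb_op2_mul_free f r hw).
rewrite lhsE rhsE; congr (_ *r _).
apply: (@rota_baxter_assoc k lambda H _ P (rb_mul_bilin lambda X)
  (@rb_op_shuffle k lambda X) f g (W c) Pfg fPg fg).
apply: IHn => //; apply: leq_trans le_n; rewrite -depth_bracket.
exact: depth_brk_head.
Qed.

Lemma rb_mulA : associative (rb_mul lambda (X := X)).
Proof.
suff LA : {morph (fun f => (rb_mul lambda f : H -> H)) : f g / f *r g >-> f \o g}.
  by move=> f g h; apply: esym (congr1 (fun F : H -> H => F h) (LA f g)).
apply: rb_mul_morphism.
- by [].
- by move=> f c x y; apply/funext.
- move=> f c x y; apply/funext => e.
  exact: (rb_mulr_linear lambda f c (x e) (y e)).
- by move=> c x y; apply/funext => e; apply: (rb_mull_linear lambda e c x y).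
- by move=> u v ruv; apply/funext => e; apply: rb_mul_cat_assoc.
move=> f g Pfg fPg fg; apply/funext => e; apply: rb_op_assoc => {}e.
- exact: (congr1 (fun F : H -> H => F e) Pfg).
- exact: (congr1 (fun F : H -> H => F e) fPg).
- exact: (congr1 (fun F : H -> H => F e) fg).
Qed.

End Associativity.

(** * Tensor products *)

Section TensorExtensionality.
Variables (k : comPzRingType) (M N L : lmodType k).

Lemma tensor_ext (F G : tensor M N -> L) : linear F -> linear G ->
  (forall m n, F (m *t n) = G (m *t n)) -> F =1 G.
Proof.
move=> linF linG FG x; rewrite (tlift_unique linF) (tlift_unique linG).
by apply: eq_bigr => p _; apply: FG.
Qed.

Lemma pureDl m m' n : (m + m') *t n = m *t n + m' *t n :> tensor M N.
Proof. exact: (lin_add ((pure_bilin M N).2 n)). Qed.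

Lemma pureDr m n n' : m *t (n + n') = m *t n + m *t n' :> tensor M N.
Proof. exact: (lin_add ((pure_bilin M N).1 m)). Qed.

Lemma pureZl c m n : (c *: m) *t n = c *: (m *t n) :> tensor M N.
Proof. exact: (lin_scale c ((pure_bilin M N).2 n)). Qed.

Lemma pureZr c m n : m *t (c *: n) = c *: (m *t n) :> tensor M N.
Proof. exact: (lin_scale c ((pure_bilin M N).1 m)). Qed.

End TensorExtensionality.

Section TensorMaps.
Variables (k : comPzRingType) (M N M' N' L : lmodType k).

Lemma tensor_ext2 (F G : tensor M N -> tensor M' N' -> L) :
    bilin F -> bilin G ->
    (forall m n m' n', F (m *t n) (m' *t n') = G (m *t n) (m' *t n')) ->
  forall x y, F x y = G x y.
Proof.
move=> [Fr Fl] [Gr Gl] FG x y.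
apply: (tensor_ext (Fr x) (Gr x)) => m' n' {y}.
by apply: (tensor_ext (Fl _) (Gl _)) => m n.
Qed.

Lemma pure_comp_bilin (f : M -> M') (g : N -> N') : linear f -> linear g ->
  bilin (fun m n => f m *t g n).
Proof.
have [pr pl] := pure_bilin M' N'.
by move=> linf ling; split=> [m|n]; [apply: comp_linear (pr _)|apply: comp_linear (pl _)].
Qed.

Lemma tmap_linear (f : M -> M') (g : N -> N') : linear f -> linear g ->
  linear (tmap f g).
Proof. by move=> linf ling; apply: tlift_linear (pure_comp_bilin linf ling). Qed.

Lemma tmap_pure (f : M -> M') (g : N -> N') m n : linear f -> linear g ->
  tmap f g (m *t n) = f m *t g n.
Proof.
by move=> linf ling; rewrite /tmap tlift_pure //; apply: pure_comp_bilin.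
Qed.

End TensorMaps.

Section TensorAssociator.
Variables (k : comPzRingType) (M N L : lmodType k).

Lemma tassoc_inner_bilin (l : L) : bilin (fun (m : M) (n : N) => m *t (n *t l)).
Proof. exact: pure_comp_bilin (@id_linear _ M) ((pure_bilin N L).2 l). Qed.

Lemma tassoc_bilin :
  bilin (fun (x : tensor M N) (l : L) => tlift (fun m n => m *t (n *t l)) x).
Proof.
split=> [x|l]; last exact: tlift_linear (tassoc_inner_bilin l).
move=> c l l'; rewrite /tlift scaler_sumr -big_split; apply: eq_bigr => p _ /=.
by rewrite pureDr pureZr pureDr pureZr.
Qed.

Lemma tassoc_linear : linear (@tassoc k M N L).
Proof. exact: tlift_linear tassoc_bilin. Qed.

Lemma tassoc_pure (m : M) (n : N) (l : L) :
  tassoc ((m *t n) *t l) = m *t (n *t l).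
Proof.
rewrite /tassoc tlift_pure; last exact: tassoc_bilin.
by rewrite tlift_pure //; apply: tassoc_inner_bilin.
Qed.

End TensorAssociator.

Section TensorProductAlgebra.
Variables (k : comPzRingType) (A B : lmodType k).
Variables (mulA : A -> A -> A) (mulB : B -> B -> B).
Hypotheses (bA : bilin mulA) (bB : bilin mulB).
Local Notation mulT := (tmul mulA mulB).

Let mT := tmul_pure bA bB.
Let bT := tmul_bilin bA bB.

Lemma tmulA : associative mulA -> associative mulB -> associative mulT.
Proof.
move=> mA mB x y z; have [Tr Tl] := bT.
have bL : bilin (fun x y => mulT x (mulT y z)).
  split=> [x'|y']; last exact: Tl.
  exact: comp_linear (Tl z) (Tr x').
have bR : bilin (fun x y => mulT (mulT x y) z).
  by split=> [x'|y']; apply: comp_linear (Tl z); [apply: Tr|apply: Tl].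
apply: (tensor_ext2 bL bR) => a b a' b' {x y bL bR}.
apply: (tensor_ext (comp_linear (Tr (a' *t b')) (Tr (a *t b)))
  (Tr (mulT (a *t b) (a' *t b')))).
by move=> a'' b''; rewrite !mT mA mB.
Qed.

Lemma tmul1l e e' : left_id e mulA -> left_id e' mulB -> left_id (e *t e') mulT.
Proof.
move=> eA eB; apply: (tensor_ext (bT.1 _) (@id_linear _ _)) => a b.
by rewrite mT eA eB.
Qed.

Section Multiplicative.
Variables (C : lmodType k) (mulC : C -> C -> C).
Hypothesis bC : bilin mulC.

Lemma tensor_morphism (F : tensor A B -> C) : linear F ->
    (forall a b a' b',
       F (mulA a a' *t mulB b b') = mulC (F (a *t b)) (F (a' *t b'))) ->
  {morph F : x y / mulT x y >-> mulC x y}.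
Proof.
move=> linF FM; have [Tr Tl] := bT; have [Cr Cl] := bC.
have bL : bilin (fun x y => F (mulT x y)).
  by split=> [x|y]; apply: comp_linear linF; [apply: Tr|apply: Tl].
have bR : bilin (fun x y => mulC (F x) (F y)).
  split=> [x|y]; [exact: comp_linear linF (Cr _)|].
  exact: comp_linear linF (Cl _).
by apply: (tensor_ext2 bL bR) => a b a' b'; rewrite mT FM.
Qed.

End Multiplicative.

Variables (A' B' : lmodType k) (mulA' : A' -> A' -> A') (mulB' : B' -> B' -> B').
Hypotheses (bA' : bilin mulA') (bB' : bilin mulB').

Lemma tmap_morphism (f : A -> A') (g : B -> B') : linear f -> linear g ->
    {morph f : x y / mulA x y >-> mulA' x y} ->
    {morph g : x y / mulB x y >-> mulB' x y} ->
  {morph tmap f g : x y / mulT x y >-> tmul mulA' mulB' x y}.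
Proof.
move=> linf ling fM gM; apply: tensor_morphism.
- exact: tmul_bilin.
- exact: tmap_linear.
by move=> a b a' b'; rewrite !tmap_pure // fM gM tmul_pure.
Qed.

End TensorProductAlgebra.

Section TensorAssociativity.
Variables (k : comPzRingType) (A B C : lmodType k).
Variables (mulA : A -> A -> A) (mulB : B -> B -> B) (mulC : C -> C -> C).
Hypotheses (bA : bilin mulA) (bB : bilin mulB) (bC : bilin mulC).

Lemma tassoc_morphism : {morph @tassoc k A B C : x y /
  tmul (tmul mulA mulB) mulC x y >-> tmul mulA (tmul mulB mulC) x y}.
Proof.
have bAB := tmul_bilin bA bB; have bBC := tmul_bilin bB bC.
have bABC := tmul_bilin bA bBC; have linT := @tassoc_linear k A B C.
apply: tensor_morphism => // x c y c'.
have [pr pl] := pure_bilin A B.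
have pln (c0 : C) : linear (fun x : tensor A B => tassoc (x *t c0)).
  exact: comp_linear ((pure_bilin (tensor A B) C).2 c0) linT.
have bL : bilin (fun x y => tassoc (tmul mulA mulB x y *t mulC c c')).
  by split=> [x'|y']; apply: comp_linear (pln _); [apply: bAB.1|apply: bAB.2].
have bR : bilin (fun x y =>
    tmul mulA (tmul mulB mulC) (tassoc (x *t c)) (tassoc (y *t c'))).
  split=> [x'|y']; first exact: comp_linear (pln _) (bABC.1 _).
  exact: (comp_linear (pln c) (bABC.2 _)).
apply: (tensor_ext2 bL bR) => a b a' b'.
by rewrite tmul_pure // !tassoc_pure !tmul_pure.
Qed.

End TensorAssociativity.

Section TensorRotaBaxter.
Variables (k : comPzRingType) (lambda : k) (A : lmodType k).
Variables (mul : A -> A -> A) (one : A) (P : A -> A).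
Hypotheses (mul_bilin : bilin mul) (P_linear : linear P).
Hypotheses (mul1l : left_id one mul) (mul1r : right_id one mul).
Hypothesis P_rb : forall f g,
  mul (P f) (P g) = P (mul (P f) g + mul f (P g) + lambda *: mul f g).
Local Notation Q := (tmap (id : A -> A) P).
Local Notation "x ** y" := (tmul mul mul x y) (at level 40, left associativity).

Let mT := tmul_pure mul_bilin mul_bilin.
Let bT := tmul_bilin mul_bilin mul_bilin.
Let QP (m n : A) : Q (m *t n) = m *t P n.
Proof. by rewrite tmap_pure. Qed.
Let linQ : linear Q.
Proof. exact: tmap_linear. Qed.

Lemma tmap_rota_baxter x y :
  Q x ** Q y = Q (Q x ** y + x ** Q y + lambda *: (x ** y)).
Proof.
have [Tr Tl] := bT.
have bL : bilin (fun x y => Q x ** Q y).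
  by split=> [x'|y']; [exact: comp_linear linQ (Tr _)|exact: comp_linear linQ (Tl _)].
have bR : bilin (fun x y => Q (Q x ** y + x ** Q y + lambda *: (x ** y))).
  split=> [x'|y']; apply: comp_linear linQ.
    apply: add_linear (scale_linear lambda (Tr _)).
    exact: add_linear (Tr _) (comp_linear linQ (Tr _)).
  apply: add_linear (scale_linear lambda (Tl _)).
  exact: add_linear (comp_linear linQ (Tl _)) (Tl _).
apply: (tensor_ext2 bL bR) => a b a' b'.
by rewrite !QP !mT P_rb -pureZr -!pureDr QP.
Qed.

Lemma tmap_mul_left f x : (f *t one) ** Q x = Q ((f *t one) ** x).
Proof.
have [Tr Tl] := bT.
apply: (tensor_ext (comp_linear linQ (Tr _)) (comp_linear (Tr _) linQ)) => a b.
by rewrite QP !mT !mul1l QP.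
Qed.

Lemma tmap_mul_right f x : Q x ** (f *t one) = Q (x ** (f *t one)).
Proof.
have [Tr Tl] := bT.
apply: (tensor_ext (comp_linear linQ (Tl _)) (comp_linear (Tl _) linQ)) => a b.
by rewrite QP !mT !mul1r QP.
Qed.

End TensorRotaBaxter.

(** * Coproduct and counit *)

Section Bialgebra.
Variables (k : comPzRingType) (lambda : k) (X : Type).
Local Notation H := (FRB k X).
Local Notation W := (word_vec k).
Local Notation P := (@rb_op k X).
Local Notation one := (rb_one k X).
Local Notation D := (@rb_coprod k lambda X).
Local Notation eps := (rb_counit k X).
Local Notation "f *r g" := (rb_mul lambda f g) (at level 40, left associativity).
Local Notation mulT := (tmul (rb_mul lambda (X := X)) (rb_mul lambda (X := X))).
Implicit Types (f g h : H) (u v w a b : bword X).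

Let bM := rb_mul_bilin lambda X.
Let bT := tmul_bilin bM bM.
Let linP : linear P := @rb_op_linear k X.
Let linD : linear D := rb_coprod_linear lambda (X := X).

(** The variables and the operator generate [H] as an algebra: a word is the
    product of its letters, and a bracket is [P] of a word of smaller depth. *)
Lemma rb_morphism_ext (A : lmodType k) (mulA : A -> A -> A) (phi psi : H -> A) :
    linear phi -> linear psi ->
    {morph phi : f g / f *r g >-> mulA f g} ->
    {morph psi : f g / f *r g >-> mulA f g} ->
    phi one = psi one ->
    (forall x, phi (W [:: Var x]) = psi (W [:: Var x])) ->
    (forall f, phi f = psi f -> phi (P f) = psi (P f)) ->
  phi =1 psi.
Proof.
move=> linphi linpsi phiM psiM eq1 eqX eqP.
apply: (word_linear_ext linphi linpsi) => w.
move: {2}_.+1 (ltnSn (depth w)) => n; elim: n w => // n IHn w; rewrite ltnS.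
elim: w => // l w IHw; rewrite [depth _]/= geq_max => /andP [dl dw] rlw.
have [rl rw lw] := @rbw_cat _ [:: l] w rlw.
rewrite -[l :: w]/([:: l] ++ w) -(rb_mul_free lambda lw) phiM psiM (IHw dw rw).
case: l rl {rlw lw} dl => [x _ _|a /rbw_brk_inv ra da]; first by rewrite eqX.
by rewrite -rb_op_word // (eqP _ (IHn a da ra)).
Qed.

Lemma rb_coprod_free u v : u ++ v \in rbw X ->
  D (W (u ++ v)) = mulT (D (W u)) (D (W v)).
Proof.
elim: u => [|l u IHu] ruv.
  rewrite [D (W [::])]rb_coprod1; apply/esym; apply: tmul1l => //; exact: rb_mul1l.
have [_ ruv' _] := @rbw_cat _ [:: l] (u ++ v) ruv.
have [ru _ _] := @rbw_cat _ (l :: u) v ruv.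
rewrite (rb_coprod_cons lambda ruv) (IHu ruv') (rb_coprod_cons lambda ru).
by rewrite (tmulA bM bM (@rb_mulA k lambda X) (@rb_mulA k lambda X)).
Qed.

(** The cocycle formula for [D (P f)] makes both sides equal to
    [P f P g (x) 1 + Q (D (rb_shuffle f g))], where [Q = id (x) P]. *)
Lemma rb_coprodM : {morph D : f g / f *r g >-> mulT f g}.
Proof.
have [Tr Tl] := bT.
apply: rb_mul_morphism.
- exact: tmulA bM bM (@rb_mulA k lambda X) (@rb_mulA k lambda X).
- exact: Tl.
- by move=> f; apply: Tr.
- exact: linD.
- exact: rb_coprod_free.
move=> f g Pfg fPg fg.
have TDl x := lin_add (Tl x); have TDr x := lin_add (Tr x).
have linQ : linear (tmap (id : H -> H) P) by apply: tmap_linear.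
have QD := lin_add linQ; have QZ c := lin_scale c linQ.
have ml := @rb_mul1l k lambda X; have mr := @rb_mul1r k lambda X.
have PfPg := @rb_op_shuffle k lambda X f g.
rewrite PfPg rb_coprod_op -PfPg /rb_shuffle !(lin_add linD) (lin_scale _ linD).
rewrite Pfg fPg fg !rb_coprod_op; move: (D f) (D g) => x y.
rewrite !(TDl, TDr) (tmul_pure bM bM) ml.
rewrite (tmap_rota_baxter bM linP (@rb_op_shuffle k lambda X)).
rewrite (tmap_mul_left bM linP ml) (tmap_mul_right bM linP mr).
rewrite !(QD, QZ) -!addrA; congr (_ + _).
by congr (_ + _); apply: addrCA.
Qed.

Lemma rb_counit_linear : linear eps.
Proof. exact: linext_linear. Qed.

Lemma rb_counit_word w : w \in rbw X -> eps (W w) = if w == [::] then 1 else 0.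
Proof. exact: (@linext_word k X k^o (fun w => if w == [::] then 1 else 0)). Qed.

Lemma rb_counit1 : eps one = 1.
Proof. by rewrite rb_counit_word ?rbw_nil. Qed.

Lemma rb_counit_op f : eps (P f) = 0.
Proof.
have lin0 : linear (fun _ : H => 0 : k^o).
  by move=> c x y; rewrite scaler0 addr0.
apply: (word_linear_ext (comp_linear linP rb_counit_linear) lin0) => w rw.
by rewrite rb_op_word // rb_counit_word // rbw_brk.
Qed.

Lemma rb_counitM : {morph eps : f g / f *r g >-> (f : k^o) * g}.
Proof.
apply: rb_mul_morphism.
- exact: mulrA.
- move=> x c y z; rewrite mulrDl; congr (_ + _); apply/esym; exact: mulrA.
- move=> f c y z; rewrite mulrDr; congr (_ + _); exact: mulrCA.
- exact: rb_counit_linear.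
- move=> u v ruv; have [ru rv _] := rbw_cat ruv; rewrite !rb_counit_word //.
  by case: u {ruv ru} => [|l u] /=; rewrite ?mul1r ?mul0r.
by move=> f g _ _ _; rewrite rb_op_shuffle !rb_counit_op mul0r.
Qed.

Lemma scale_bilin (M : lmodType k) : bilin (fun (c : k^o) (x : M) => (c : k) *: x).
Proof.
split=> [a|x] c y z; first by rewrite scalerDr !scalerA mulrC.
by rewrite scalerDl -scalerA.
Qed.

Lemma rb_coprod_counitl f :
  tlift (fun (a : k^o) (y : H) => (a : k) *: y) (tmap eps id (D f)) = f.
Proof.
have bS := scale_bilin H; have linE := rb_counit_linear.
have linEid : linear (tmap eps (id : H -> H)) by apply: tmap_linear.
pose E (x : tensor H H) : H :=
  tlift (fun (a : k^o) (y : H) => (a : k) *: y) (tmap eps id x).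
have EP g h : E (g *t h) = (eps g : k) *: h by rewrite /E tmap_pure // tlift_pure.
have linE' : linear E by exact: comp_linear linEid (tlift_linear bS).
have EM : {morph E : x y / mulT x y >-> x *r y}.
  apply: tensor_morphism => // g h g' h'.
  by rewrite !EP rb_counitM rb_mulZl rb_mulZr scalerA.
rewrite -/(E _); move: f.
apply: (rb_morphism_ext (mulA := rb_mul lambda (X := X))) => //.
- exact: comp_linear linD linE'.
- by move=> f g; rewrite rb_coprodM EM.
- by rewrite rb_coprod1 EP rb_counit1 scale1r.
- move=> x; rewrite rb_coprod_var (lin_add linE') !EP rb_counit1 scale1r.
  by rewrite rb_counit_word ?rbwP // scale0r add0r.
move=> f Ef; rewrite rb_coprod_op (lin_add linE') EP rb_counit_op scale0r add0r.
rewrite -[in RHS]Ef; move: (D f).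
have linQ : linear (tmap (id : H -> H) P) by apply: tmap_linear.
apply: (tensor_ext (comp_linear linQ linE') (comp_linear linE' linP)) => g h.
by rewrite tmap_pure // !EP rb_opZ.
Qed.

Lemma rb_coprod_counitr f :
  tlift (fun (y : H) (a : k^o) => (a : k) *: y) (tmap id eps (D f)) = f.
Proof.
have bS : bilin (fun (y : H) (a : k^o) => (a : k) *: y).
  by have [Sr Sl] := scale_bilin H; split.
have linE := rb_counit_linear.
have linEid : linear (tmap (id : H -> H) eps) by apply: tmap_linear.
pose E (x : tensor H H) : H :=
  tlift (fun (y : H) (a : k^o) => (a : k) *: y) (tmap id eps x).
have EP g h : E (g *t h) = (eps h : k) *: g by rewrite /E tmap_pure // tlift_pure.
have linE' : linear E by exact: comp_linear linEid (tlift_linear bS).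
have EM : {morph E : x y / mulT x y >-> x *r y}.
  apply: tensor_morphism => // g h g' h'.
  by rewrite !EP rb_counitM rb_mulZl rb_mulZr scalerA.
rewrite -/(E _); move: f.
apply: (rb_morphism_ext (mulA := rb_mul lambda (X := X))) => //.
- exact: comp_linear linD linE'.
- by move=> f g; rewrite rb_coprodM EM.
- by rewrite rb_coprod1 EP rb_counit1 scale1r.
- move=> x; rewrite rb_coprod_var (lin_add linE') !EP rb_counit1 scale1r.
  by rewrite rb_counit_word ?rbwP // scale0r addr0.
move=> f _; rewrite rb_coprod_op (lin_add linE') EP rb_counit1 scale1r.
suff -> : E (tmap id P (D f)) = 0 by rewrite addr0.
have lin0 : linear (fun _ : tensor H H => 0 : H).
  by move=> c x y; rewrite scaler0 addr0.
have linQ : linear (tmap (id : H -> H) P) by apply: tmap_linear.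
apply: (tensor_ext (comp_linear linQ linE') lin0) => g h.
by rewrite tmap_pure // !EP rb_counit_op scale0r.
Qed.

(** At [P f] the left side is [P f (x) 1 (x) 1 + Q (D f) (x) 1] plus
    [id (x) Q] of the left side at [f]. The right side has the same shape: in
    the second factor [D (P g)] is [P g (x) 1 + Q (D g)]. *)
Lemma rb_coprodA f : tassoc (tmap D id (D f)) = tmap id D (D f).
Proof.
have linDi : linear (tmap D (id : H -> H)) by apply: tmap_linear.
have liniD : linear (tmap (id : H -> H) D) by apply: tmap_linear.
have linA := @tassoc_linear k H H H.
have linL := comp_linear (comp_linear linD linDi) linA.
have linR := comp_linear linD liniD.
have idM : {morph (id : H -> H) : f g / f *r g >-> f *r g} by [].
move: f; apply: (rb_morphism_ext (mulA := tmul (rb_mul lambda (X := X)) mulT)) => //.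
- move=> f g; rewrite rb_coprodM.
  by rewrite (tmap_morphism bM bM bT bM) // ?tassoc_morphism //; apply: rb_coprodM.
- move=> f g; rewrite rb_coprodM.
  by rewrite (tmap_morphism bM bM bM bT) //; apply: rb_coprodM.
- by rewrite rb_coprod1 !tmap_pure // rb_coprod1 tassoc_pure.
- move=> x; rewrite rb_coprod_var (lin_add linDi) (lin_add linA) (lin_add liniD).
  rewrite !tmap_pure // rb_coprod1 rb_coprod_var.
  by rewrite pureDl (lin_add linA) !tassoc_pure pureDr addrA.
move=> f Df; rewrite rb_coprod_op (lin_add linDi) (lin_add linA) (lin_add liniD).
rewrite !tmap_pure // rb_coprod1 rb_coprod_op.
rewrite pureDl (lin_add linA) !tassoc_pure -addrA; congr (_ + _).
have linQ : linear (tmap (id : H -> H) P) by apply: tmap_linear.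
have linQQ : linear (tmap (id : H -> H) (tmap (id : H -> H) P)).
  by apply: tmap_linear.
(* The left side at [P f] in terms of the left side at [f]. *)
have -> : tassoc (tmap D id (tmap id P (D f))) =
    tmap id (tmap id P) (tassoc (tmap D id (D f))).
  have linF := comp_linear (comp_linear linQ linDi) linA.
  have linG := comp_linear (comp_linear linDi linA) linQQ.
  move: (D f); apply: (tensor_ext linF linG) => g h; rewrite !tmap_pure //.
  have linF' := comp_linear ((pure_bilin (tensor H H) H).2 (P h)) linA.
  have linG' := comp_linear
    (comp_linear ((pure_bilin (tensor H H) H).2 h) linA) linQQ.
  move: (D g); apply: (tensor_ext linF' linG') => g1 g2.
  by rewrite !tassoc_pure tmap_pure // tmap_pure.
rewrite Df; move: (D f) => x.
have linF : linear (fun x => tassoc (tmap (id : H -> H) P x *t one) +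
    tmap id (tmap (id : H -> H) P) (tmap id D x)).
  apply: add_linear; last exact: comp_linear liniD linQQ.
  exact: comp_linear (comp_linear linQ ((pure_bilin (tensor H H) H).2 one)) linA.
apply: (tensor_ext linF (comp_linear linQ liniD)) => g h {x linF}.
by rewrite !tmap_pure // tassoc_pure rb_coprod_op pureDr.
Qed.

End Bialgebra.

Theorem theorem3p2 (k : comPzRingType) (lambda : k) (X : Type) :
  is_bialgebra (H := FRB k X)
    (rb_mul lambda) (rb_unit k X) (rb_coprod lambda) (rb_counit k X).
Proof.
have unit1 : rb_unit k X 1 = rb_one k X by rewrite /rb_unit scale1r.
have linU : linear (rb_unit k X).
  by move=> c x y; rewrite /rb_unit scalerDl -scalerA.
split; split=> //.
- exact: rb_mul_bilin.
- exact: rb_mulA.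
- by rewrite unit1; apply: rb_mul1l.
- by rewrite unit1; apply: rb_mul1r.
- exact: rb_coprod_linear.
- exact: rb_counit_linear.
- exact: rb_coprodA.
- exact: rb_coprod_counitl.
- exact: rb_coprod_counitr.
- exact: rb_coprod_linear.
- exact: rb_coprodM.
- move=> c; rewrite /tunit unit1 pureZl -(rb_coprod1 lambda).
  exact: (lin_scale _ (rb_coprod_linear lambda (X := X))).
- exact: rb_counit_linear.
- exact: rb_counitM.
move=> c; rewrite /rb_unit (lin_scale _ (@rb_counit_linear k X)) rb_counit1.
exact: mulr1.
Qed.
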